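(* Let $\omega:[0,+\infty)\to[0,+\infty)$ be a nondecreasing continuous function such that $\omega(\mu)>0$ for every $\mu>0$ and $\int_1^{+\infty}\frac{\omega(\mu)}{\mu^2}\,d\mu=+\infty$. Let $d$ be a positive integer, let $\Omega\subseteq\mathbb{R}^d$ be a connected open set, and let $u:\Omega\to\mathbb{R}$ be a measurable function that is not essentially constant. Then $\mathscr{F}_\omega(u,\Omega)=+\infty$.
   Context: For a measurable $u:\Omega\to\mathbb{R}$, $$\mathscr{F}_\omega(u,\Omega):=\iint_{\Omega\times\Omega}\omega\left(\frac{|u(y)-u(x)|}{|y-x|}\right)\frac{1}{|y-x|^d}\,dx\,dy\in[0,+\infty].$$ A measurable function is essentially constant if it coincides almost everywhere with a constant. *)

(* Defs.v *)
From HB Require Import structures.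
From mathcomp Require Import all_boot all_order all_algebra.
From mathcomp Require Import all_classical all_reals all_analysis.
Import Order.TTheory GRing.Theory Num.Theory.
Import numFieldNormedType.Exports.

Set Implicit Arguments.
Unset Strict Implicit.
Unset Printing Implicit Defensive.

Local Open Scope classical_set_scope.
Local Open Scope ring_scope.

(* R^n is 'rV[R]_n.  The library provides its topology, but neither its
   Lebesgue measure nor its Euclidean distance ([`|x|] is the sup norm). *)

Definition euclid_dist (R : realType) (n : nat) (x y : 'rV[R]_n) : R :=
  Num.sqrt (\sum_(i < n) (x 0 i - y 0 i) ^+ 2).

Section boxes.
Context {R : realType} {n : nat}.
Implicit Types a b : 'rV[R]_n.

Definition box a b : set 'rV[R]_n :=
  [set x | forall i, a 0 i <= x 0 i <= b 0 i].

(* The volume of [box a b], provided that a <= b in each coordinate. *)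
Definition box_vol a b : R := \prod_(i < n) (b 0 i - a 0 i).

Definition box_cover (A : set 'rV[R]_n) : set (nat -> 'rV[R]_n * 'rV[R]_n) :=
  [set B : nat -> 'rV[R]_n * 'rV[R]_n |
    (forall k i, (B k).1 0 i <= (B k).2 0 i) /\
    A `<=` \bigcup_k box (B k).1 (B k).2].

Lemma box_vol_ge0 a b : (forall i, a 0 i <= b 0 i) -> 0 <= box_vol a b.
Proof. by move=> ab; apply: prodr_ge0 => i _; rewrite subr_ge0. Qed.

End boxes.

(* Lebesgue outer measure.  The dimension is d.+1: in dimension 0 every box has
   volume 1, so that the infimum would be +oo even for the empty set. *)
Definition lebesgue_outer (R : realType) (d : nat) (A : set 'rV[R]_d.+1) :
    \bar R :=
  ereal_inf [set (\sum_(k <oo) (box_vol (B k).1 (B k).2)%:E)%E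
            | B in box_cover A].

Section lebesgue_outer_measure.
Local Open Scope ereal_scope.
Context (R : realType) (d : nat).
Local Notation V := 'rV[R]_d.+1.
Local Notation mu := (@lebesgue_outer R d).
Implicit Types (A : set V) (B : nat -> V * V).

Let vol (p : V * V) : \bar R := (box_vol p.1 p.2)%:E.

Let cover_ge0 A B k : box_cover A B -> 0 <= vol (B k).
Proof. by move=> [AB _]; rewrite lee_fin box_vol_ge0. Qed.

Let lebesgue_outer_ge0 A : 0 <= mu A.
Proof.
apply: le_ereal_inf_tmp => _ [B AB <-].
by apply: nneseries_ge0 => k _ _; exact: cover_ge0 AB.
Qed.

Let lebesgue_outer0 : mu set0 = 0.
Proof.
apply/eqP; rewrite eq_le lebesgue_outer_ge0 andbT.
apply: ereal_inf_lbound; exists (fun=> (0, 0)%R); first by split.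
apply: eseries0 => k _ _ /=; congr EFin.
by rewrite /box_vol big_ord_recl subrr mul0r.
Qed.

Let le_lebesgue_outer : {homo mu : A B / A `<=` B >-> A <= B}.
Proof.
move=> A A' AA'; apply/ereal_inf_le_tmp => _ [B [Bn A'B] <-].
by exists B => //; split => //; exact: subset_trans A'B.
Qed.

Let lebesgue_outer_sigma_subadditive : sigma_subadditive mu.
Proof.
move=> A; have [[i ioo]|] := pselect (exists i, mu (A i) = +oo).
  rewrite (eseries_pinfty _ _ ioo) ?leey// => k _.
  by rewrite -ltNye (lt_le_trans _ (lebesgue_outer_ge0 _)).
rewrite -forallNE => Aoo.
suff add2e (e : {posnum R}) :
    mu (\bigcup_k A k) <= \sum_(i <oo) mu (A i) + e%:num%:E.
  by apply/lee_addgt0Pr => _/posnumP[].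
rewrite (le_trans _ (epsilon_trick _ _ _))//.
pose P k B := box_cover (A k) B /\
  \sum_(j <oo) vol (B j) <= mu (A k) + (e%:num / (2 ^ k.+1)%:R)%:E.
have [G PG] : {G : nat -> nat -> V * V & forall k, P k (G k)}.
  apply: (@choice _ _ P) => k; rewrite /P /lebesgue_outer.
  set S := (X in ereal_inf X); move infS : (ereal_inf S) => iS.
  case: iS infS => [r Sr|Soo|Soo].
  - have ek : (0 < e%:num / (2 ^ k.+1)%:R)%R by [].
    have /(lb_ereal_inf_adherent ek) : ereal_inf S \is a fin_num by rewrite Sr.
    move=> [_ [B AB <-]] muB.
    by exists B; split => //; rewrite -Sr; exact/ltW.
  - by have := Aoo k; rewrite /lebesgue_outer Soo.
  - by have := lebesgue_outer_ge0 (A k); rewrite /lebesgue_outer Soo.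
have G0 x : 0 <= (vol \o uncurry G) x.
  by case: x => i j /=; exact: cover_ge0 (PG i).1.
apply: (@le_trans _ _ (\esum_(i in setT) (vol \o uncurry G) i)).
  apply: ereal_inf_lbound => /=.
  have /card_esym/ppcard_eqP[f] := card_nat2.
  exists (uncurry G \o f).
    split => [k|].
      by rewrite /uncurry/=; case: (f k) => i j; exact: (PG i).1.1.
    move=> t [i _ /((PG i).1.2)[j _ Gt]].
    by exists (f^-1%FUN (i, j)) => //=; rewrite invK ?inE.
  rewrite -(esum_pred_image (vol \o uncurry G) _ xpredT) ?[fun=> _]set_true//.
  by rewrite image_eq.
rewrite (_ : esum _ _ = \sum_(i <oo) \sum_(j <oo) vol (G i j)); last first.
  pose J : nat -> set (nat * nat) := fun i => [set (i, j) | j in setT].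
  rewrite (_ : setT = \bigcup_k J k); last first.
    by rewrite predeqE => -[a b]; split => // _; exists a => //; exists b.
  rewrite esum_bigcupT /=; last 2 first.
    - apply/trivIsetP => i j _ _ ij.
      rewrite predeqE => -[n m] /=; split => //= -[] [_] _ [<-{n} _].
      by move=> [m' _] [] /esym/eqP; rewrite (negbTE ij).
    - by move=> x; exact: G0.
  rewrite -(image_id [set: nat]) -fun_true esum_pred_image//; last first.
    by move=> n _; apply: esum_ge0 => x _; exact: G0.
  apply: eq_eseriesr => /= j _.
  rewrite -(esum_pred_image (vol \o uncurry G) (pair j) predT)//=; last first.
  - by move=> ? ? _ _; exact: (@can_inj _ _ _ snd).
  - by move=> k _; exact: cover_ge0 (PG j).1.
  by congr esum; rewrite predeqE => -[a b]; split; move=> [i _ <-]; exists i.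
apply: lee_lim.
- apply: is_cvg_nneseries => n *.
  by apply: nneseries_ge0 => m *; exact: (cover_ge0 _ (PG n).1).
- by apply: is_cvg_nneseries => n *; apply: adde_ge0 => //; exact: lebesgue_outer_ge0.
- by near=> n; apply: lee_sum => i _; exact: (PG i).2.
Unshelve. all: by end_near. Qed.

HB.instance Definition _ := isOuterMeasure.Build R V mu
  lebesgue_outer0 lebesgue_outer_ge0 le_lebesgue_outer
  lebesgue_outer_sigma_subadditive.

End lebesgue_outer_measure.

(* R^d.+1 with its sigma-algebra of Lebesgue (Caratheodory) measurable sets. *)
Notation lebRV R d := (caratheodory_type (@lebesgue_outer R d)).

Definition lebesgue_measure_rV (R : realType) (d : nat) :
  set (lebRV R d) -> \bar R := @lebesgue_outer R d.

HB.instance Definition _ (R : realType) (d : nat) :=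
  isMeasure.Build _ (lebRV R d) R (@lebesgue_measure_rV R d)
    (@caratheodory_measure0 _ _ (@lebesgue_outer R d))
    (@caratheodory_measure_ge0 _ _ (@lebesgue_outer R d))
    (@caratheodory_measure_sigma_additive _ _ (@lebesgue_outer R d)).

Section lebesgue_sigma_finite.
Context (R : realType) (d : nat).
Local Notation V := 'rV[R]_d.+1.
Local Notation mu := (@lebesgue_outer R d).

Let vol_split (a b x y : V) (i : 'I_d.+1) :
  (forall j, j != i -> x 0 j = b 0 j) -> (forall j, j != i -> y 0 j = a 0 j) ->
  x 0 i = y 0 i -> (box_vol a x + box_vol y b = box_vol a b).
Proof.
move=> xb ya xy; rewrite /box_vol (bigD1 i)//= [in RHS](bigD1 i)//=.
rewrite [X in _ + X = _](bigD1 i)//=; set P := (X in _ = _ * X).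
have -> : \prod_(j < d.+1 | j != i) (x 0 j - a 0 j) = P.
  by apply: eq_bigr => j /xb ->.
have -> : \prod_(j < d.+1 | j != i) (b 0 j - y 0 j) = P.
  by apply: eq_bigr => j /ya ->.
by rewrite -mulrDl xy addrC addrA subrK.
Qed.

Lemma measurable_halfspace (i : 'I_d.+1) (c : R) :
  measurable ([set x | x 0 i <= c] : set (lebRV R d)).
Proof.
apply: le_caratheodory_measurable => X /=.
apply: le_ereal_inf_tmp => _ [B [Bn XB] <-].
pose m k := Num.max ((B k).1 0 i) (Num.min ((B k).2 0 i) c).
pose x k : V := (\row_j if j == i then m k else (B k).2 0 j).
pose y k : V := (\row_j if j == i then m k else (B k).1 0 j).
have am k : ((B k).1 0 i <= m k) by rewrite /m le_max lexx.
have mb k : (m k <= (B k).2 0 i) by rewrite /m ge_max Bn ge_min lexx.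
have ax k j : ((B k).1 0 j <= x k 0 j) by rewrite mxE; case: eqP => // ->.
have yb k j : (y k 0 j <= (B k).2 0 j) by rewrite mxE; case: eqP => // ->.
have -> : (\sum_(k <oo) (box_vol (B k).1 (B k).2)%:E =
    \sum_(k <oo) (box_vol (B k).1 (x k))%:E +
    \sum_(k <oo) (box_vol (y k) (B k).2)%:E)%E.
  rewrite -nneseriesD; last 2 first.
  - by move=> k _ _; rewrite lee_fin box_vol_ge0.
  - by move=> k _ _; rewrite lee_fin box_vol_ge0.
  apply: eq_eseriesr => k _; rewrite -EFinD (@vol_split _ _ _ _ i)//.
  - by move=> j /negbTE ji; rewrite mxE ji.
  - by move=> j /negbTE ji; rewrite mxE ji.
  - by rewrite !mxE eqxx.
apply: leeD; apply: ereal_inf_lbound.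
- exists (fun k => ((B k).1, x k)) => //; split => //= t [/XB[k _ Bt] tc].
  exists k => // j /=; have /andP[a1 a2] := Bt j.
  rewrite a1 mxE; case: eqP => // ji; subst j.
  by rewrite /m le_max le_min a2 tc orbT.
- exists (fun k => (y k, (B k).2)) => //; split => //= t [/XB[k _ Bt] tc].
  exists k => // j /=; have /andP[a1 a2] := Bt j.
  rewrite a2 andbT mxE; case: eqP => // ji; subst j.
  move/negP : tc; rewrite -ltNge => /ltW ct.
  by rewrite /m ge_max a1 ge_min ct orbT.
Qed.

Lemma measurable_halfspace_lt (i : 'I_d.+1) (c : R) :
  measurable ([set x | x 0 i < c] : set (lebRV R d)).
Proof.
have cE : [set x : V | x 0 i < c] =
    \bigcup_k [set x : V | x 0 i <= c - k.+1%:R^-1].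
  apply/seteqP; split => [x /= xc|x [k _ /= xc]]; last first.
    by rewrite (le_lt_trans xc)// ltrBlDr ltrDl.
  have [k xk] := ltr_add_invr xc.
  by exists k => //=; rewrite lerBrDr ltW.
apply: (eq_ind_r (fun A : set (lebRV R d) => measurable A) _ cE).
by apply: bigcup_measurable => k _; exact: measurable_halfspace.
Qed.

Lemma measurable_box (a b : V) : measurable (box a b : set (lebRV R d)).
Proof.
have abE : box a b = \bigcap_(i in [set: 'I_d.+1])
    ([set x : V | x 0 i <= b 0 i] `&` ~` [set x : V | x 0 i < a 0 i]).
  apply/seteqP; split => [x xab i _|x xab i].
    by have /andP[ax xb] := xab i; split => //=; apply/negP; rewrite -leNgt.
  by have [/= -> /negP] := xab i I; rewrite -leNgt => ->.
apply: (eq_ind_r (fun A : set (lebRV R d) => measurable A) _ abE).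
apply: fin_bigcap_measurable => // i _.
apply: measurableI; first exact: measurable_halfspace.
by apply: measurableC; exact: measurable_halfspace_lt.
Qed.

Let lebesgue_sigma_finite : sigma_finite setT (@lebesgue_measure_rV R d).
Proof.
exists (fun k => box (const_mx (- k%:R)) (const_mx k%:R)).
  apply/esym; rewrite -subTset => x _.
  exists (Num.bound (\sum_i `|x 0 i|)) => // i.
  rewrite !mxE -ler_norml; apply: ltW.
  apply: le_lt_trans (archi_boundP _); last by apply: sumr_ge0.
  by rewrite (bigD1 i)//= lerDl sumr_ge0.
move=> k; split; first exact: measurable_box.
set a : V := const_mx (- k%:R); set b : V := const_mx k%:R.
have ab i : (a 0 i <= b 0 i) by rewrite !mxE -subr_ge0 opprK addr_ge0.
apply: (@le_lt_trans _ _ (box_vol a b)%:E); last exact: ltry.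
apply: ereal_inf_lbound.
exists (fun j => if j is 0%N then (a, b) else (0 : V, 0 : V)).
  split; first by case.
  by move=> x xab; exists 0%N.
rewrite nneseries_recl//; last first.
  case=> [|j] _ //=; rewrite lee_fin box_vol_ge0//.
rewrite eseries_cond/= eseries0 ?adde0// => -[|j]//= _ _.
by rewrite /box_vol big_ord_recl subrr mul0r.
Qed.

HB.instance Definition _ := Measure_isSigmaFinite.Build _ _ _
  (@lebesgue_measure_rV R d) lebesgue_sigma_finite.

End lebesgue_sigma_finite.

Arguments lebesgue_measure_rV {R d}.

(* A function Omega -> R is represented by a function on the whole space, whose
   values outside Omega are irrelevant. *)
Definition essentially_constant (R : realType) (d : nat)
    (Omega : set 'rV[R]_d.+1) (u : 'rV[R]_d.+1 -> R) : Prop :=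
  exists c : R, {ae lebesgue_measure_rV, forall x, Omega x -> u x = c}.

(* On the (negligible) diagonal x = y this is omega 0 / 0 = 0. *)
Definition Fkernel (R : realType) (d : nat) (omega : R -> R)
    (u : 'rV[R]_d.+1 -> R) (x y : 'rV[R]_d.+1) : R :=
  omega (`|u y - u x| / euclid_dist y x) / euclid_dist y x ^+ d.+1.

Definition Fomega (R : realType) (d : nat) (omega : R -> R)
    (u : 'rV[R]_d.+1 -> R) (Omega : set 'rV[R]_d.+1) : \bar R :=
  (\int[lebesgue_measure_rV \x lebesgue_measure_rV]_(p in
     (Omega `*` Omega : set (lebRV R d * lebRV R d)))
     (Fkernel omega u p.1 p.2)%:E)%E.

(* Main.v *)
Require Import Defs.
From mathcomp Require Import all_boot all_order all_algebra.
From mathcomp Require Import all_classical all_reals all_analysis.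
From mathcomp Require Import measurable_realfun ring lra.
Import Order.TTheory GRing.Theory Num.Theory.
Import numFieldNormedType.Exports.

Set Implicit Arguments.
Unset Strict Implicit.
Unset Printing Implicit Defensive.

Local Open Scope classical_set_scope.
Local Open Scope ring_scope.

(** Suppose the functional is finite. The proof shows that u is then
essentially constant on every ball inside Omega; connectedness does the rest
([essentially_constant_local]).

The heart is a statement about an arbitrary function v and one segment [x, x +
h] with v (x + h) <> v x. Cut the segment into 2 ^ k equal pieces, and let S_k
be the sum of omega (difference quotient) over the pieces. Then sum_k 2 ^ - k
* S_k = +oo ([dyadic_sum_diverges]). Indeed, the quotient of a segment is at
most the mean of the quotients of its two halves. For a threshold l, min (q /
l, 1) is therefore at most the mean of the same expression over the halves,
plus the mean of the indicators of [q >= l]: either both quotients of the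
halves are below l, and truncation is harmless, or one of the indicators pays
for everything. Adding these inequalities over l = 2 ^ j, with the increments
of omega as weights, turns the indicators into omega ([layer_le_omega]) and
gives a potential Psi with Psi (q) <= mean (Psi + omega) over the halves.
Iterated, this bounds Psi (q) by the partial sums of the series plus the mean
of Psi over the finest pieces, and the latter is negligible if the series
converges. Finally, by summation by parts, Psi (q) is unbounded when the
number of thresholds grows, precisely because the integral of omega (m) / m ^
2 diverges ([potential_unbounded]).

To use this on a ball B, write the functional in the variables (x, h), with y
= x + h, as the integral over h of |h| ^ - (d + 1) * I (h), where I (h) is the
integral over x of omega (difference quotient between x and x + h). By
translation invariance, the integral over x of S_k is 2 ^ k * I (h / 2 ^ k).
The measure |h| ^ - (d + 1) dh is invariant under dilations, so integrating
sum_k I (h / 2 ^ k) against it over an annulus s / 2 <= |h| < s (of the sup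
norm) gives the integral of |h| ^ - (d + 1) * I (h) over the union of the
disjoint annuli with outer radii s / 2 ^ k, which is at most the functional.
Hence sum_k I (h / 2 ^ k) < +oo for almost every h
([null_directional_energy_series]), and the statement on segments forces v (x
+ h) = v x for almost every x with x and x + h in B ([null_jump]). By Tonelli,
v is essentially constant on B ([cut_kernel_finite_constant]).

Tonelli in the variables (x, h) needs (x, h) |-> v (x + h) to be measurable
for the product sigma-algebra, which may fail if v is only Lebesgue
measurable. So v is a Borel function that agrees with u outside a Borel null
set Z ([borel_version]), and the pairs that meet Z are discarded from the
kernel. *)

(** * Dyadic subdivisions of a segment *)

Section dyadic_sum.
Context {R : realType} {V : lmodType R}.
Implicit Types (f g : V -> V -> R) (x h : V).

Definition half h : V := 2^-1 *: h.

Lemma halfD h : half h + half h = h.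
Proof. by rewrite /half -scalerDl -[RHS]scale1r; congr (_ *: _); field. Qed.

Lemma half_iter k h : iter k half h = (2 ^- k) *: h.
Proof.
elim: k => [|k IH]; first by rewrite expr0 invr1 scale1r.
by rewrite iterS IH /half scalerA -invfM -exprS.
Qed.

(** The arguments of f are the base point and the direction of a piece of the
segment [x, x + h]. The recursion follows the tree of halvings, so that
statements about all the 2 ^ k pieces are proved by induction on k. *)
Fixpoint dyadic_sum f k x h : R :=
  if k is k'.+1 then
    dyadic_sum f k' x (half h) + dyadic_sum f k' (x + half h) (half h)
  else f x h.

(** The recursion cuts the whole segment first; cutting each of the finest
pieces last gives the same sum. *)
Lemma dyadic_sum_split f k x h :
  dyadic_sum f k.+1 x h =
  dyadic_sum (fun y v => f y (half v) + f (y + half v) (half v)) k x h.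
Proof. by elim: k x h => [//|k IH] x h; rewrite /= -!IH. Qed.

Lemma dyadic_sumD f g k x h : dyadic_sum (fun y v => f y v + g y v) k x h =
  dyadic_sum f k x h + dyadic_sum g k x h.
Proof. by elim: k x h => [//|k IH] x h /=; rewrite !IH addrACA. Qed.

Lemma dyadic_sumZ (c : R) f k x h :
  dyadic_sum (fun y v => c * f y v) k x h = c * dyadic_sum f k x h.
Proof. by elim: k x h => [//|k IH] x h /=; rewrite !IH mulrDr. Qed.

Lemma dyadic_sum_cst (c : R) k x h :
  dyadic_sum (fun _ _ => c) k x h = 2 ^+ k * c.
Proof.
elim: k x h => [|k IH] x h /=; first by rewrite expr0 mul1r.
by rewrite !IH exprS; ring.
Qed.

Lemma dyadic_sum_ge0 f k x h : (forall y v, 0 <= f y v) ->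
  0 <= dyadic_sum f k x h.
Proof. by move=> f0; elim: k x h => [//|k IH] x h /=; rewrite addr_ge0. Qed.

Definition dyadic_stable (P : V -> V -> Prop) := forall x h,
  P x h -> P x (half h) /\ P (x + half h) (half h).

Lemma le_dyadic_sum (P : V -> V -> Prop) f g k x h : dyadic_stable P ->
  (forall y v, P y v -> f y v <= g y v) -> P x h ->
  dyadic_sum f k x h <= dyadic_sum g k x h.
Proof.
move=> stP fg; elim: k x h => [|k IH] x h Pxh /=; first exact: fg.
by have [P1 P2] := stP _ _ Pxh; rewrite lerD ?IH.
Qed.

End dyadic_sum.

(** * The divergence of dyadic sums *)

Section potential.
Context {R : realType} (omega : R -> R).
Hypothesis omega_ge0 : forall m : R, 0 <= m -> 0 <= omega m.
Hypothesis omega_nondecreasing :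
  forall m1 m2 : R, 0 <= m1 -> m1 <= m2 -> omega m1 <= omega m2.
Hypothesis omega_gt0 : forall m : R, 0 < m -> 0 < omega m.

Let dom j : R := omega (2 ^+ j.+1) - omega (2 ^+ j).

(** A discrete version of the integral of min (r / l, 1) with respect to the
Stieltjes measure of omega in the variable l, at the thresholds l = 2 ^ (j +
1) for j < n. *)
Definition potential n (r : R) : R :=
  \sum_(j < n) (omega (2 ^+ j.+1) - omega (2 ^+ j)) * Num.min (r / 2 ^+ j.+1) 1.

Let dom_ge0 j : 0 <= dom j.
Proof.
rewrite subr_ge0 omega_nondecreasing ?exprn_ge0//.
by rewrite ler_weXn2l// ler1n.
Qed.

Let sum_dom n : \sum_(j < n) dom j = omega (2 ^+ n) - omega 1.
Proof.
elim: n => [|n IH]; first by rewrite big_ord0 expr0 subrr.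
by rewrite big_ord_recr/= IH /dom; ring.
Qed.

(** Layer-cake: the increments of omega below r telescope to at most omega r.
*)
Lemma layer_le_omega n (r : R) : 0 <= r ->
  \sum_(j < n) dom j * (2 ^+ j.+1 <= r)%R%:R <= omega r.
Proof.
move=> r0; elim: n => [|n IH]; first by rewrite big_ord0 omega_ge0.
have [nr|nr] := leP (2 ^+ n.+1) r; last first.
  by rewrite big_ord_recr/= (lt_geF nr) mulr0 addr0.
apply: (@le_trans _ _ (\sum_(j < n.+1) dom j)).
  apply: ler_sum => j _; rewrite -[leRHS]mulr1 ler_wpM2l//.
  by case: (2 ^+ j.+1 <= r).
rewrite sum_dom (le_trans (_ : _ <= omega (2 ^+ n.+1)))//.
  by rewrite gerBl omega_ge0.
by rewrite omega_nondecreasing ?exprn_ge0.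
Qed.

Lemma le_potential n (r s : R) : r <= s -> potential n r <= potential n s.
Proof.
move=> rs; apply: ler_sum => j _; rewrite ler_wpM2l ?dom_ge0//.
rewrite le_min ge_min ge_min lexx !orbT andbT.
by rewrite ler_pM2r ?invr_gt0 ?exprn_gt0// rs.
Qed.

Lemma potential_le_omega n (r : R) : potential n r <= omega (2 ^+ n).
Proof.
apply: (@le_trans _ _ (\sum_(j < n) dom j)).
  apply: ler_sum => j _; rewrite -[leRHS]mulr1 ler_wpM2l ?dom_ge0//.
  by rewrite ge_min lexx orbT.
by rewrite sum_dom gerBl omega_ge0.
Qed.

Lemma potential_le_linear n (r : R) : 0 <= r ->
  potential n r <= r * omega (2 ^+ n).
Proof.
move=> r0; apply: (@le_trans _ _ (r * \sum_(j < n) dom j)); last first.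
  by rewrite ler_wpM2l// sum_dom gerBl omega_ge0.
rewrite mulr_sumr; apply: ler_sum => j _; rewrite mulrC ler_wpM2r ?dom_ge0//.
by rewrite ge_min ler_pdivrMr ?exprn_gt0// ler_peMr// exprn_ege1// ?ler1n.
Qed.

(** If r1 and r2 are both below l, no truncation occurs on the right and this
is the hypothesis; otherwise one of the indicators is 1 and the truncated term
of that half is 1 as well, which already makes the right-hand side at least 1.
*)
Lemma truncation_midpoint (l r r1 r2 : R) : 0 < l -> 0 <= r1 -> 0 <= r2 ->
  r <= (r1 + r2) / 2 ->
  Num.min (r / l) 1 <= (Num.min (r1 / l) 1 + Num.min (r2 / l) 1
                        + ((l <= r1)%R%:R + (l <= r2)%R%:R)) / 2.
Proof.
move=> l0 r10 r20 rm.
have m1 : 0 <= r1 / l by rewrite divr_ge0// ltW.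
have m2 : 0 <= r2 / l by rewrite divr_ge0// ltW.
have rl : r / l <= (r1 / l + r2 / l) / 2.
  by rewrite -mulrDl mulrAC ler_pM2r ?invr_gt0.
rewrite -[X in X <= r1](mul1r l) -[X in X <= r2](mul1r l) -!ler_pdivlMr//.
move: rl m1 m2; move: (r / l) (r1 / l) (r2 / l) => a b c abc b0 c0.
rewrite !minEle.
case: (leP a 1) => ?; case: (leP b 1) => ?; case: (leP c 1) => ?;
  case: (leP 1 b) => ?; case: (leP 1 c) => ? /=; lra.
Qed.

Lemma potential_midpoint n (r r1 r2 : R) : 0 <= r1 -> 0 <= r2 ->
  r <= (r1 + r2) / 2 ->
  potential n r <=
    2^-1 * ((potential n r1 + omega r1) + (potential n r2 + omega r2)).
Proof.
move=> r10 r20 rm.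
have := layer_le_omega n r20; have := layer_le_omega n r10.
set s1 := (X in X <= _ -> _); set s2 := (X in _ -> X <= _ -> _) => h1 h2.
apply: (@le_trans _ _
   (2^-1 * ((potential n r1 + s1) + (potential n r2 + s2)))); last lra.
rewrite /s1 /s2 /potential -!big_split/= mulr_sumr; apply: ler_sum => j _.
have lj : 0 < 2 ^+ j.+1 :> R by rewrite exprn_gt0.
have := truncation_midpoint lj r10 r20 rm.
rewrite -/(dom j); move: (dom_ge0 j).
by move=> D0 H; have := ler_wpM2l D0 H; lra.
Qed.

Hypothesis omega_series : forall A : R, exists n,
  A <= \sum_(j < n) omega (2 ^+ j.+1) / 2 ^+ j.+1.

(** Summation by parts turns the weighted increments of omega into half of the
series of [omega_series], up to bounded terms. *)
Lemma potential_unbounded (r A : R) : 0 < r -> exists n, A <= potential n r.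
Proof.
move=> r0.
have m0 : 0 < Num.min r 1 by rewrite lt_min r0 ltr01.
have [n hn] := omega_series (2 * (A / Num.min r 1) + omega 1).
exists n.
apply: (@le_trans _ _ (Num.min r 1 * \sum_(j < n) dom j / 2 ^+ j.+1)).
  rewrite mulrC -ler_pdivrMr//.
  (* Abel summation, with b_j = omega (2 ^ j) / 2 ^ j. *)
  have -> : \sum_(j < n) dom j / 2 ^+ j.+1 =
     2^-1 * (\sum_(j < n) omega (2 ^+ j.+1) / 2 ^+ j.+1) +
     2^-1 * (omega (2 ^+ n) / 2 ^+ n) - omega 1 / 2.
    elim: (n) => [|k IH]; first by rewrite !big_ord0 expr0; field.
    rewrite !big_ord_recr/= IH /dom; move: (omega (2 ^+ k.+1)) => W.
    have k0 : 2 ^+ k != 0 :> R by rewrite expf_neq0.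
    by rewrite exprS; field; rewrite k0.
  have : 0 <= omega (2 ^+ n) / 2 ^+ n.
    by rewrite divr_ge0 ?omega_ge0 ?exprn_ge0.
  move: hn; set t := \sum_(_ < _) _; lra.
rewrite mulr_sumr; apply: ler_sum => j _.
rewrite mulrCA ler_wpM2l ?dom_ge0// le_min.
have j0 : 0 < 2 ^+ j.+1 :> R by rewrite exprn_gt0.
rewrite ler_pM2r ?invr_gt0// ge_min lexx/= ler_pdivrMr// mul1r ge_min.
by rewrite exprn_ege1 ?orbT// ler1n.
Qed.

Section divergence.
Context {V : lmodType R} (P : V -> V -> Prop) (q : V -> V -> R).
Hypothesis stP : dyadic_stable P.
Hypothesis q_ge0 : forall x h, 0 <= q x h.
Hypothesis q_midpoint : forall x h, P x h ->
  q x h <= (q x (half h) + q (x + half h) (half h)) / 2.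

(** One halving costs the omega terms of the new pieces; N halvings leave the
potential of the 2 ^ N finest ones. *)
Lemma potential_le_dyadic n N x h : P x h ->
  potential n (q x h) <=
  \sum_(k < N) 2 ^- k.+1 * dyadic_sum (fun y g => omega (q y g)) k.+1 x h +
  2 ^- N * dyadic_sum (fun y g => potential n (q y g)) N x h.
Proof.
move=> Pxh; elim: N => [|N IH].
  by rewrite big_ord0 add0r expr0 invr1 mul1r.
apply: (le_trans IH); rewrite big_ord_recr/= -addrA lerD2l.
rewrite -!/(dyadic_sum _ N.+1 x h) -mulrDr addrC -dyadic_sumD dyadic_sum_split.
rewrite exprS invfM [_^-1 * _ ^-1]mulrC -mulrA ler_pM2l ?invr_gt0 ?exprn_gt0//.
rewrite -dyadic_sumZ; apply: le_dyadic_sum stP _ Pxh => y g Pyg.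
by apply: potential_midpoint => //; exact: q_midpoint.
Qed.

(** If the partial sums were bounded by A, choose n with potential at least A
+ 2. On the finest pieces the potential is at most 1 + C * omega (q): at most
1 where q is below a small level l, and at most omega (2 ^ n) = C * omega l
elsewhere. So each term of the series is at least 1 / C, and the series
diverges. *)
Lemma dyadic_sum_diverges x h (A : R) : P x h -> 0 < q x h -> exists N,
  A < \sum_(k < N) 2 ^- k * dyadic_sum (fun y g => omega (q y g)) k x h.
Proof.
move=> Pxh q0; apply: contrapT => /forallNP bnd.
pose a k := 2 ^- k * dyadic_sum (fun y g => omega (q y g)) k x h.
have {}bnd N : \sum_(k < N) a k <= A by rewrite leNgt; apply/negP/bnd.
have a0 k : 0 <= a k.
  rewrite mulr_ge0 ?invr_ge0 ?exprn_ge0// dyadic_sum_ge0// => y g.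
  exact: omega_ge0.
have [n An] := potential_unbounded (A + 2) q0.
have w0 : 0 < omega (2 ^+ n) by rewrite omega_gt0 ?exprn_gt0.
(* The level l is chosen so that l * omega (2 ^ n) = 1. *)
pose l := (omega (2 ^+ n))^-1; have l0 : 0 < l by rewrite invr_gt0.
pose C := omega (2 ^+ n) / omega l.
have C0 : 0 < C by rewrite divr_gt0 ?omega_gt0.
have leaf y g : potential n (q y g) <= 1 + C * omega (q y g).
  have [ql|lq] := leP (q y g) l.
    apply: ler_wpDr; first by rewrite mulr_ge0 ?(ltW C0) ?omega_ge0.
    apply: (le_trans (le_potential n ql)).
    apply: (le_trans (potential_le_linear _ (ltW l0))).
    by rewrite /l mulVf ?gt_eqF.
  rewrite ler_wpDl// (le_trans (potential_le_omega _ _))//.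
  rewrite /C mulrAC ler_pdivlMr ?omega_gt0// ler_pM2l//.
  by rewrite omega_nondecreasing// ltW.
have aC N : 1 <= C * a N.
  have := potential_le_dyadic n N Pxh.
  have : \sum_(k < N) a k.+1 <= A.
    have := bnd N.+1; rewrite big_ord_recl; apply: le_trans.
    by rewrite ler_wpDl.
  rewrite /a; set t := \sum_(_ < _) _ => tA.
  have : 2 ^- N * dyadic_sum (fun y g => potential n (q y g)) N x h
      <= 1 + C * a N.
    rewrite mulrC ler_pdivrMr ?exprn_gt0//.
    apply: (@le_trans _ _
        (dyadic_sum (fun y g => 1 + C * omega (q y g)) N x h)).
      exact: le_dyadic_sum stP _ Pxh.
    rewrite dyadic_sumD dyadic_sum_cst dyadic_sumZ /a.
    have k0 : 2 ^+ N != 0 :> R by rewrite expf_neq0.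
    by rewrite le_eqVlt; apply/orP; left; apply/eqP; field.
  move: tA An; rewrite /a; lra.
have [N AN] : exists N : nat, A < N%:R / C.
  exists (Num.bound `|A * C|); rewrite ltr_pdivlMr//.
  by rewrite (le_lt_trans (ler_norm _))// archi_boundP.
have := bnd N; rewrite leNgt => /negP; apply.
apply: (lt_le_trans AN).
rewrite mulr_natl -[X in _ *+ X](card_ord N) -sumr_const; apply: ler_sum => k _.
by rewrite -[leLHS]mul1r ler_pdivrMr// mulrC aC.
Qed.

End divergence.
End potential.

(** * The growth condition on omega *)

Lemma measurable_invr {R : realType} : measurable_fun [set: R] (@GRing.inv R).
Proof.
rewrite (_ : [set: R] = ~` [set 0] `|` [set 0]); last by rewrite setUC setUv.
apply/measurable_funU => //; first exact: measurableC.
split; last exact: measurable_fun_set1.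
apply: open_continuous_measurable_fun; 
  first exact: (closed_openC (@closed_eq R 0)).
by move=> x; rewrite inE/= => /eqP x0; exact: inv_continuous.
Qed.

Section omega.
Context {R : realType} (omega : R -> R).
Hypothesis omega_ge0 : forall m : R, 0 <= m -> 0 <= omega m.
Hypothesis omega_nondecreasing :
  forall m1 m2 : R, 0 <= m1 -> m1 <= m2 -> omega m1 <= omega m2.

Lemma measurable_omega : measurable_fun (`[0, +oo[%classic : set R) omega.
Proof.
apply: (eq_measurable_fun (fun r : R => omega (Num.max 0 r))).
  by move=> r; rewrite inE/= in_itv/= andbT => r0; rewrite max_r.
apply: nondecreasing_measurable => // r s rs.
apply: omega_nondecreasing; first by rewrite le_max lexx.
by rewrite ge_max !le_max lexx rs orbT.
Qed.

Lemma measurable_omega_comp {dT} {T : measurableType dT} (f : T -> R) :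
  measurable_fun setT f -> (forall t, 0 <= f t) ->
  measurable_fun setT (omega \o f).
Proof.
move=> mf f0; apply: (measurable_comp _ _ measurable_omega mf) => //.
by move=> _ [t _ <-]; rewrite /= in_itv/= f0.
Qed.

(** On [2 ^ j, 2 ^ (j + 1)[ the integrand is at most omega (2 ^ (j + 1)) / 4 ^
j and the length is 2 ^ j, so the integral is at most twice the dyadic series.
*)
Lemma omega_dyadic_series :
  (\int[lebesgue_measure]_(m in `[1%R, +oo[) (omega m / m ^+ 2)%:E = +oo)%E ->
  forall A : R, exists n, A <= \sum_(j < n) omega (2 ^+ j.+1) / 2 ^+ j.+1.
Proof.
move=> ioo A; apply: contrapT => /forallNP bnd.
have {}bnd n : \sum_(j < n) omega (2 ^+ j.+1) / 2 ^+ j.+1 <= A.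
  by apply: ltW; rewrite ltNge; apply/negP.
pose F j : set R := `[2 ^+ j, 2 ^+ j.+1[%classic.
have pow_gt0 j : 0 < 2 ^+ j :> R by rewrite exprn_gt0.
have pow_le i j : (i <= j)%N -> 2 ^+ i <= 2 ^+ j :> R.
  by move=> ij; rewrite ler_weXn2l// ler1n.
have FE : `[1, +oo[%classic = \bigcup_j F j.
  apply/seteqP; split => x /=; last first.
    move=> [j _]; rewrite /F/= !in_itv/= andbT => /andP[jx _].
    by rewrite (le_trans _ jx)// -[leLHS](expr0 2) pow_le.
  rewrite in_itv/= andbT => x1.
  have exn : exists n, x < 2 ^+ n.
    exists (Num.bound x).
    rewrite (lt_le_trans (archi_boundP _)) ?(le_trans _ x1)//.
    by rewrite -natrX ler_nat ltnW// ltn_expl.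
  case: (ex_minnP exn) => -[|n] xn nmin.
    by move: xn; rewrite expr0 ltNge x1.
  exists n => //; rewrite /F/= in_itv/= xn andbT leNgt; apply/negP => /nmin.
  by rewrite ltnn.
have int_ge0 (x : R) : 1 <= x -> (0 <= (omega x / x ^+ 2)%:E)%E.
  move=> x1; rewrite lee_fin divr_ge0 ?sqr_ge0// omega_ge0//.
  exact: le_trans x1.
have mint : measurable_fun (`[1, +oo[%classic : set R)
    (fun x : R => (omega x / x ^+ 2)%:E).
  apply/measurable_EFinP; apply: measurable_funM.
    apply: measurable_funS measurable_omega => //.
    by move=> x /=; rewrite !in_itv/= !andbT; exact: le_trans.
  apply: measurable_funTS; apply: (measurableT_comp measurable_invr).
  exact: measurable_funX.
move: ioo; rewrite FE ge0_integral_bigcup//; last 4 first.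
- by move=> k; exact: measurable_itv.
- by rewrite -FE.
- by rewrite -FE => x /=; rewrite in_itv/= andbT; exact: int_ge0.
- apply/trivIsetP => i j _ _; wlog ij : i j / (i < j)%N => [H|_].
    rewrite neq_ltn => /orP[ij|ji]; first by rewrite H// ltn_eqF.
    by rewrite setIC H// ltn_eqF.
  rewrite -subset0 => x [] /=.
  rewrite /F/= !in_itv/= => /andP[_ xi] /andP[jx _].
  by move: (le_lt_trans jx xi); rewrite ltNge pow_le.
apply/eqP; rewrite lt_eqF//.
apply: (@le_lt_trans _ _ (2 * A)%:E); last exact: ltry.
apply: lime_le.
  apply: is_cvg_nneseries => k _ _; apply: integral_ge0 => x.
  rewrite /F/= in_itv/= => /andP[kx _]; apply: int_ge0; apply: le_trans kx.
  by rewrite -[leLHS](expr0 2) pow_le.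
apply: nearW => n; rewrite big_mkord.
apply: (@le_trans _ _
  (\sum_(j < n) (2 * (omega (2 ^+ j.+1) / 2 ^+ j.+1))%:E)%E);
  last by rewrite sumEFin -mulr_sumr lee_fin ler_pM2l.
apply: lee_sum => j _.
apply: (@le_trans _ _
    (\int[lebesgue_measure]_(x in F j)
      (cst (omega (2 ^+ j.+1) / (2 ^+ j) ^+ 2)%:E x))%E).
  apply: ge0_le_integral => //.
  - exact: measurable_itv.
  - move=> x; rewrite /F/= in_itv/= => /andP[kx _]; apply: int_ge0.
    by apply: le_trans kx; rewrite -[leLHS](expr0 2) pow_le.
  - apply: measurable_funS mint => //; rewrite FE; exact: bigcup_sup.
  - move=> x; rewrite /F/= in_itv/= => /andP[jx xj].
    have x0 : 0 < x by exact: lt_le_trans jx.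
    rewrite lee_fin ler_pM ?omega_ge0 ?invr_ge0 ?sqr_ge0 ?(ltW x0)//.
      by rewrite omega_nondecreasing ?ltW.
    by rewrite lef_pV2 ?posrE ?exprn_gt0// ler_pXn2r// nnegrE ltW.
rewrite integral_cst//=; last exact: measurable_itv.
rewrite lebesgue_measure_itv/= lte_fin ltr_eXn2l ?ltr1n// ltnSn -EFinD -EFinM.
rewrite lee_fin le_eqVlt; apply/orP; left; apply/eqP.
by rewrite !exprS; field; rewrite gt_eqF.
Qed.

End omega.

(** * Affine changes of variables *)

Section affine.
Context {R : realType} {d : nat}.
Local Notation V := 'rV[R]_d.+1.
Local Notation L := (lebRV R d).
Local Notation mu := (@lebesgue_measure_rV R d).
Implicit Types (A : set V) (a x : V) (c : R).

Definition affine c a (x : V) : V := c *: x + a.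

Lemma affineK c a : c != 0 -> cancel (affine c a) (affine c^-1 (- (c^-1 *: a))).
Proof.
by move=> c0 x; rewrite /affine scalerDr scalerA mulVf// scale1r addrK.
Qed.

Lemma affine_invK c a : c != 0 ->
  cancel (affine c^-1 (- (c^-1 *: a))) (affine c a).
Proof.
move=> c0 x; rewrite /affine scalerDr scalerA mulfV// scale1r scalerN scalerA.
by rewrite mulfV// scale1r subrK.
Qed.

Let outer_affine_le c a A : 0 < c ->
  (lebesgue_outer (affine c a @^-1` A) <=
   (c^-1 ^+ d.+1)%:E * lebesgue_outer A)%E.
Proof.
move=> c0; have c'0 : 0 < c^-1 by rewrite invr_gt0.
have p0 : 0 < c^-1 ^+ d.+1 by rewrite exprn_gt0.
rewrite muleC -lee_pdivrMr// muleC.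
apply: le_ereal_inf_tmp => _ [B [Bn AB] <-].
rewrite muleC lee_pdivrMr// muleC.
pose g (b : V) : V := c^-1 *: (b - a).
pose B' k := (g (B k).1, g (B k).2).
have le_g (x y : V) i : x 0 i <= y 0 i -> g x 0 i <= g y 0 i.
  by move=> xy; rewrite !mxE ler_pM2l// lerD2r.
have -> : ((c^-1 ^+ d.+1)%:E * \sum_(k <oo) (box_vol (B k).1 (B k).2)%:E =
    \sum_(k <oo) (box_vol (B' k).1 (B' k).2)%:E)%E.
  rewrite -nneseriesZl; last by move=> k _; rewrite lee_fin box_vol_ge0.
  apply: eq_eseriesr => k _; rewrite -EFinM; congr EFin.
  rewrite /box_vol -[X in _ ^+ X](card_ord d.+1) -prodr_const -big_split/=.
  by apply: eq_bigr => i _; rewrite !mxE -mulrBr; congr (_ * _); ring.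
apply: ereal_inf_lbound; exists B' => //; split.
  by move=> k i; exact: le_g.
move=> x /AB[k _ xB]; exists k => //= i.
have /andP[h1 h2] := xB i; have := le_g _ _ _ h1; have := le_g _ _ _ h2.
by rewrite /g /affine addrK scalerA mulVf ?gt_eqF// scale1r => -> ->.
Qed.

Let outer_ge0 A : (0 <= lebesgue_outer A)%E.
Proof. exact: (outer_measure_ge0 (@lebesgue_outer R d)). Qed.

(** The inequality above for the inverse affine map is the converse
inequality. *)
Lemma lebesgue_outer_affine c a A : 0 < c ->
  (lebesgue_outer (affine c a @^-1` A) =
   (c^-1 ^+ d.+1)%:E * lebesgue_outer A)%E.
Proof.
move=> c0; have c'0 : 0 < c^-1 by rewrite invr_gt0.
have p0 : 0 < c ^+ d.+1 by rewrite exprn_gt0.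
apply/eqP; rewrite eq_le outer_affine_le//=.
have := outer_affine_le (- (c^-1 *: a)) (affine c a @^-1` A) c'0.
rewrite -comp_preimage.
have -> : affine c a \o affine c^-1 (- (c^-1 *: a)) = id.
  by apply/funext => x /=; rewrite affine_invK// gt_eqF.
rewrite invrK => h.
rewrite exprVn muleC lee_pdivrMr// muleC.
exact: h.
Qed.

Lemma caratheodory_affine c a A : 0 < c ->
  caratheodory_measurable (@lebesgue_outer R d) A ->
  caratheodory_measurable (@lebesgue_outer R d) (affine c a @^-1` A).
Proof.
move=> c0 mA X; pose Y : set V := affine c^-1 (- (c^-1 *: a)) @^-1` X.
have XY : X = affine c a @^-1` Y.
  rewrite -comp_preimage; have -> // :
      affine c^-1 (- (c^-1 *: a)) \o affine c a = id.
  by apply/funext => x /=; rewrite affineK// gt_eqF.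
rewrite XY; clear XY; clearbody Y; clear X.
change (lebesgue_outer (affine c a @^-1` Y) =
  (lebesgue_outer (affine c a @^-1` (Y `&` A)) +
   lebesgue_outer (affine c a @^-1` (Y `&` ~` A)))%E).
apply: (etrans (lebesgue_outer_affine a Y c0)).
apply: (etrans (congr1 (mule _) (mA Y))).
apply: (etrans (ge0_muleDr _ (outer_ge0 _) (outer_ge0 _))).
by apply: (congr2 adde); apply/esym; exact: lebesgue_outer_affine.
Qed.

Lemma measurable_affine c a : 0 < c ->
  measurable_fun setT (affine c a : L -> L).
Proof. by move=> c0 _ A mA; rewrite setTI; exact: caratheodory_affine. Qed.

Lemma ge0_integral_affine c a (f : V -> \bar R) : 0 < c ->
  measurable_fun (setT : set L) (f : L -> \bar R) -> (forall x, 0 <= f x)%E ->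
  (\int[mu]_x f (affine c a x) = (c^-1 ^+ d.+1)%:E * \int[mu]_x f x)%E.
Proof.
move=> c0 mf f0.
have := ge0_integral_pushforward (measurable_affine a c0) mu
  measurableT mf (fun x _ => f0 x).
rewrite preimage_setT => <-.
have p0 : 0 <= c^-1 ^+ d.+1 by rewrite exprn_ge0// invr_ge0 ltW.
rewrite (eq_measure_integral (mscale (NngNum p0) mu)).
  by rewrite ge0_integral_mscale.
  exact: measurable_affine.
by move=> mphi A mA _; exact: (lebesgue_outer_affine a A c0).
Qed.

Lemma ge0_integral_translate a (f : V -> \bar R) :
  measurable_fun (setT : set L) (f : L -> \bar R) -> (forall x, 0 <= f x)%E ->
  (\int[mu]_x f (x + a)%R = \int[mu]_x f x)%E.
Proof.
move=> mf f0; have := ge0_integral_affine a ltr01 mf f0.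
rewrite invr1 expr1n mul1e => <-; apply: eq_integral => x _.
by rewrite /affine scale1r.
Qed.

End affine.

(** * Borel sets *)

Section borel.
Context {R : realType} {d : nat}.
Local Notation V := 'rV[R]_d.+1.
Local Notation L := (lebRV R d).
Local Notation mu := (@lebesgue_measure_rV R d).

(** Generators of the Borel sets for which measurability of a map into the
space is measurability of its coordinates ([measurable_borelP]). *)
Definition halfspaces : set (set V) :=
  [set A | exists i c, A = [set x : V | x 0 i <= c]].

Local Notation borelRV := (g_sigma_algebraType halfspaces).

Lemma measurable_coord i : measurable_fun (setT : set borelRV)
  ((fun x : V => x 0 i) : borelRV -> R).
Proof.
apply: (measurability _ (RGenOInfty.measurableE R)) => //= _ [_ [c ->] <-].
rewrite setTI -[X in measurable X]setCK; apply: measurableC.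
apply: sub_gen_smallest; exists i, c.
by apply/seteqP; split => x /=; rewrite in_itv/= andbT leNgt => /negP.
Qed.

Lemma measurable_borelP {dT} {T : measurableType dT} (f : T -> V) :
  (forall i, measurable_fun (setT : set T) ((fun t => f t 0 i) : T -> R)) ->
  measurable_fun (setT : set T) (f : T -> borelRV).
Proof.
move=> mf; apply: (@measurability _ _ _ borelRV _ _ halfspaces) => //.
move=> _ [_ [i [c ->]] <-].
by apply: (mf i measurableT [set y | y <= c]); rewrite -set_itvNyc.
Qed.

Lemma measurable_id_borel : measurable_fun (setT : set L) (id : L -> borelRV).
Proof.
apply: (@measurability _ _ _ borelRV _ _ halfspaces) => // _ [_ [i [c ->]] <-].
by rewrite setTI; exact: measurable_halfspace.
Qed.

Lemma borel_measurable (A : set V) : measurable (A : set borelRV) ->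
  measurable (A : set L).
Proof.
by move=> mA; have := measurable_id_borel measurableT mA; rewrite setTI.
Qed.

(** The reason for the Borel sigma-algebra: the preimage under addition of a
Lebesgue null set need not belong to the product sigma-algebra. *)
Lemma measurable_add_borel : measurable_fun (setT : set (L * L))
  ((fun p => (p.1 : V) + p.2) : L * L -> borelRV).
Proof.
apply: measurable_borelP => i.
have mc : measurable_fun (setT : set L) ((fun x : V => x 0 i) : L -> R).
  exact: (measurableT_comp (measurable_coord i) measurable_id_borel).
rewrite (_ : (fun _ => _) = (fun p : L * L => (p.1 : V) 0 i + (p.2 : V) 0 i)).
  apply: measurable_funD.
    exact: (measurableT_comp mc measurable_fst).
  exact: (measurableT_comp mc measurable_snd).
by apply/funext => p; rewrite mxE.
Qed.

Lemma borel_coords (I : 'I_d.+1 -> set R) : (forall i, measurable (I i)) ->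
  measurable ([set x | forall i, I i (x 0 i)] : set borelRV).
Proof.
move=> mI; have E : [set x : V | forall i, I i (x 0 i)] =
    \bigcap_(i in [set: 'I_d.+1]) ((fun x : V => x 0 i) @^-1` I i).
  by apply/seteqP; split => [x h i _|x h i]; [exact: h|exact: h].
apply: (eq_ind_r (fun A : set borelRV => measurable A) _ E).
apply: fin_bigcap_measurable => // i _.
by have := measurable_coord i measurableT (mI i); rewrite setTI.
Qed.

Lemma borel_box (a b : V) : measurable (box a b : set borelRV).
Proof.
have E : box a b = [set x | forall i, [set` `[a 0 i, b 0 i]] (x 0 i)].
  by apply/seteqP; split => x h i; have := h i; rewrite /= in_itv.
apply: (eq_ind_r (fun A : set borelRV => measurable A) _ E).
apply: (@borel_coords (fun i => `[a 0 i, b 0 i]%classic)) => i.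
exact: measurable_itv.
Qed.

Lemma ball_coords (x : V) (r : R) : 0 < r -> ball x r =
  [set y | forall i, ball (x 0 i) r (y 0 i)].
Proof.
move=> r0; apply/seteqP; split => [y [_ xy] i|y xy]; first exact: xy.
by split => // i j; rewrite ord1.
Qed.

Lemma borel_ball (x : V) (r : R) : measurable (ball x r : set borelRV).
Proof.
have [r0|r0] := ltP 0 r; last first.
  have E : ball x r = set0.
    rewrite -subset0 => y; rewrite mx_norm_ball.
    by move=> /(le_lt_trans (normr_ge0 _)); rewrite ltNge r0.
  apply: (eq_ind_r (fun A : set borelRV => measurable A) _ E).
  exact: measurable0.
apply: (eq_ind_r (fun A : set borelRV => measurable A) _ (ball_coords x r0)).
apply: (@borel_coords (fun i => ball (x 0 i) r)) => i.
exact: measurable_ball.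
Qed.

End borel.

(** * Null sets and Borel versions *)

Section null_sets.
Context {R : realType} {d : nat}.
Local Notation V := 'rV[R]_d.+1.
Local Notation L := (lebRV R d).
Local Notation mu := (@lebesgue_measure_rV R d).
Local Notation outer := (@lebesgue_outer R d).
Local Notation borelRV := (g_sigma_algebraType (@halfspaces R d)).

Definition null (A : set V) : Prop := outer A = 0%E.

Let outer_ge0 A : (0 <= outer A)%E.
Proof. exact: (outer_measure_ge0 (@lebesgue_outer R d)). Qed.

Let le_outer A B : A `<=` B -> (outer A <= outer B)%E.
Proof. exact: (le_outer_measure (@lebesgue_outer R d)). Qed.

Lemma null_sub (A B : set V) : A `<=` B -> null B -> null A.
Proof.
move=> AB B0; apply/eqP; rewrite /null eq_le outer_ge0 andbT.
by rewrite (le_trans (le_outer AB))// B0.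
Qed.

Lemma null_bigcup (F : nat -> set V) : (forall n, null (F n)) ->
  null (\bigcup_n F n).
Proof.
move=> F0; apply/eqP; rewrite /null eq_le outer_ge0 andbT.
have := outer_measure_sigma_subadditive (@lebesgue_outer R d) F.
move=> /le_trans; apply; rewrite eseries0// => k _ _; exact: F0.
Qed.

Lemma null_countable (I : countType) (F : I -> set V) :
  (forall i, null (F i)) -> null (\bigcup_i F i).
Proof.
move=> F0.
apply: (@null_sub _ (\bigcup_n (if unpickle n is Some i then F i else set0))).
  by move=> x [i _ Fx]; exists (pickle i) => //; rewrite pickleK.
apply: null_bigcup => n; case: unpickle => [i|]; first exact: F0.
exact: (outer_measure0 (@lebesgue_outer R d)).
Qed.

Lemma null_setU (A B : set V) : null A -> null B -> null (A `|` B).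
Proof.
move=> A0 B0; apply: (@null_sub _ (\bigcup_(b : bool) (if b then A else B))).
  by move=> x [Ax|Bx]; [exists true|exists false].
by apply: null_countable => -[].
Qed.

Lemma null_affine c a (A : set V) : 0 < c -> null A ->
  null (affine c a @^-1` A).
Proof.
move=> c0 A0; rewrite /null lebesgue_outer_affine//.
by rewrite A0 mule0.
Qed.

(** Coverings by boxes that are optimal up to 1 / (n + 1) have Borel unions,
and the intersection of these unions over n is optimal. *)
Lemma borel_hull (A : set V) : exists G : set V,
  [/\ measurable (G : set borelRV), A `<=` G & (outer G <= outer A)%E].
Proof.
have [Aoo|Aoo] := eqVneq (outer A) +oo%E.
  by exists setT; split => //; rewrite Aoo leey.
have Afin : outer A \is a fin_num by rewrite ge0_fin_numE// ltey.
pose P n (B : nat -> V * V) := box_cover A B /\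
  (\sum_(k <oo) (box_vol (B k).1 (B k).2)%:E < outer A + n.+1%:R^-1%:E)%E.
have [B PB] : {B : nat -> nat -> V * V & forall n, P n (B n)}.
  apply: (@choice _ _ P) => n.
  have n0 : (0 < n.+1%:R^-1 :> R) by rewrite invr_gt0.
  have [_ [B AB <-] Bn] := lb_ereal_inf_adherent n0 Afin.
  by exists B.
pose U n : set V := \bigcup_k box (B n k).1 (B n k).2.
exists (\bigcap_n U n); split.
- apply: bigcapT_measurable => n; apply: bigcupT_measurable => k.
  exact: borel_box.
- by move=> x Ax n _; exact: (PB n).1.2.
- apply/lee_addgt0Pr => e e0.
  have [n ne] : exists n, n.+1%:R^-1 < e.
    by have [n] := ltr_add_invr e0; rewrite add0r; exists n.
  have Un : (outer (U n) <= \sum_(k <oo) (box_vol (B n k).1 (B n k).2)%:E)%E.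
    apply: ereal_inf_lbound; exists (B n) => //; split => //.
    exact: (PB n).1.1.
  have GU : \bigcap_n U n `<=` U n by move=> x; apply.
  apply: (le_trans (le_outer GU)).
  apply: (le_trans Un); apply: (le_trans (ltW (PB n).2)).
  by apply: leeD => //; rewrite lee_fin ltW.
Qed.

Lemma null_hull (A : set V) : null A -> exists Z : set V,
  [/\ measurable (Z : set borelRV), A `<=` Z & null Z].
Proof.
move=> A0; have [Z [mZ AZ]] := borel_hull A.
rewrite A0 => Z0; exists Z; split => //.
by apply/eqP; rewrite /null eq_le Z0 outer_ge0.
Qed.

Lemma negligible_null (A : set V) : mu.-negligible A <-> null A.
Proof.
split=> [[B [_ B0 AB]]|/null_hull[Z [mZ AZ Z0]]]; first exact: null_sub B0.
by exists Z; split => //; exact: borel_measurable.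
Qed.

(** If G is a Borel hull of A, then G minus A is null, by additivity and
because the measure of A is finite. Outside a Borel null set that contains G
minus A, the sets A and G coincide. *)
Let borel_mod_null_fin (A : set V) : measurable (A : set L) ->
  (outer A < +oo)%E ->
  exists Z : set V, [/\ measurable (Z : set borelRV), null Z &
    measurable (A `\` Z : set borelRV)].
Proof.
move=> mA Aoo; have [G [mG AG GA]] := borel_hull A.
have cA : caratheodory_measurable (@lebesgue_outer R d) A by exact: mA.
have N0 : null (G `\` A).
  apply/eqP; rewrite /null eq_le outer_ge0 andbT.
  have Afin : outer A \is a fin_num by rewrite ge0_fin_numE.
  have : (outer A + outer (G `\` A) <= outer A + 0)%E.
    rewrite adde0; apply: le_trans GA; rewrite le_eqVlt; apply/orP; left.
    have := cA G; rewrite (setIidr AG) => /esym H; apply/eqP; exact: H.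
  by rewrite leeD2lE.
have [Z [mZ NZ Z0]] := null_hull N0; exists Z; split => //.
have -> : A `\` Z = G `\` Z.
  apply/seteqP; split => x [x1 x2]; split => //; first exact: AG.
  by apply: contrapT => nA; apply: x2; exact: NZ.
exact: measurableD.
Qed.

Lemma borel_mod_null (A : set V) : measurable (A : set L) ->
  exists Z : set V, [/\ measurable (Z : set borelRV), null Z &
    measurable (A `\` Z : set borelRV)].
Proof.
move=> mA; have [F FT mF] := sigma_finiteT mu.
have /choice[Z PZ] : forall n, exists Z : set V,
    [/\ measurable (Z : set borelRV), null Z &
      measurable ((A `&` F n) `\` Z : set borelRV)].
  move=> n; have [mFn Fn] := mF n; apply: borel_mod_null_fin.
    exact: measurableI.
  have AF : A `&` F n `<=` F n by [].
  exact: le_lt_trans (le_outer AF) Fn.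
exists (\bigcup_n Z n); split.
- by apply: bigcupT_measurable => n; have [] := PZ n.
- by apply: null_bigcup => n; have [] := PZ n.
- have E : A `\` \bigcup_n Z n =
      (\bigcup_n ((A `&` F n) `\` Z n)) `\` \bigcup_n Z n.
    apply/seteqP; split => [x [Ax Zx]|x [[n _ [[Ax _] _]] Zx]]; last by split.
    split => //; have [n _ Fx] : (\bigcup_n F n) x by rewrite -FT.
    by exists n => //; split => // Zn; apply: Zx; exists n.
  apply: (eq_ind_r (fun A : set borelRV => measurable A) _ E).
  apply: measurableD; apply: bigcupT_measurable => n; by have [] := PZ n.
Qed.

(** The exceptional sets of the countably many sets u > q, with q rational,
have a null union Z. Outside Z these sets are Borel, so the function equal to
u on B minus Z and to 0 elsewhere is Borel. *)
Lemma borel_version (B : set V) (u : V -> R) : measurable (B : set borelRV) ->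
  measurable_fun (B : set L) (u : L -> R) ->
  exists Z : set V, exists2 v : V -> R,
    measurable_fun (setT : set borelRV) (v : borelRV -> R) &
    [/\ measurable (Z : set borelRV), null Z &
      forall x, (B `\` Z) x -> v x = u x].
Proof.
move=> mB mu_; have mBL := borel_measurable mB.
have /choice[Z PZ] : forall q : rat, exists Z : set V,
    [/\ measurable (Z : set borelRV), null Z &
      measurable ((B `&` [set x | ratr q < u x]) `\` Z : set borelRV)].
  move=> q; apply: borel_mod_null.
  have := mu_ mBL `]ratr q, +oo[%classic (measurable_itv _).
  by congr measurable; apply/seteqP; split => x [Bx];
    rewrite /= ?in_itv/= ?andbT => ?; split => //=; rewrite in_itv/= andbT.
pose N := \bigcup_q Z q.
have mN : measurable (N : set borelRV).
  by apply: countable_bigcupT_measurable => // q; have [] := PZ q.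
exists N, (fun x => if x \in B `\` N then u x else 0); last first.
  split => //; first by apply: null_countable => q; have [] := PZ q.
  by move=> x Dx; rewrite mem_set.
have mD : measurable (B `\` N : set borelRV) by exact: measurableD.
apply: (measurability _ (RGenOInfty.measurableE R)) => //= _ [_ [c ->] <-].
rewrite setTI.
pose W := \bigcup_(q in [set q : rat | c < ratr q])
  (((B `&` [set x | ratr q < u x]) `\` Z q) `\` N).
have mW : measurable (W : set borelRV).
  rewrite /W bigcup_mkcond; apply: countable_bigcupT_measurable => // q.
  case: ifPn => // _; apply: measurableD => //.
  by have [] := PZ q.
have E : (fun x => if x \in B `\` N then u x else 0) @^-1` `]c, +oo[%classic =
    W `|` (if c < 0 then ~` (B `\` N) else set0).
  apply/seteqP; split => [x|x [[q /= cq [[[Bx /= qx] _] Nx]]|]] /=.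
  - rewrite in_itv/= andbT; case: ifPn => [|xD c0].
      rewrite inE => -[Bx Nx] cu; left.
      have [q] := rat_in_itvoo cu; rewrite in_itv/= => /andP[cq qu].
      exists q => //; split => //; split => // Zx; apply: Nx; by exists q.
    by right; rewrite c0; move: xD; rewrite notin_setE.
  - by rewrite mem_set// in_itv/= andbT (lt_trans cq).
  - case: ifPn => // c0 /= nD; rewrite memNset//.
    by rewrite in_itv/= andbT.
apply: (eq_ind_r (fun A : set borelRV => measurable A) _ E).
apply: measurableU => //; case: ifPn => // _; exact: measurableC.
Qed.

End null_sets.

(** * From balls to a connected open set *)

Section local_global.
Context {R : realType} {d : nat}.
Local Notation V := 'rV[R]_d.+1.
Local Notation L := (lebRV R d).
Local Notation mu := (@lebesgue_measure_rV R d).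
Local Notation outer := (@lebesgue_outer R d).
Local Notation borelRV := (g_sigma_algebraType (@halfspaces R d)).

Definition rational_ball (p : 'rV[rat]_d.+1 * rat) : set V :=
  ball (map_mx ratr p.1 : V) (ratr p.2).

Lemma rational_ball_basis (x : V) (r : R) : 0 < r ->
  exists2 p, rational_ball p x & rational_ball p `<=` ball x r.
Proof.
move=> r0; have r20 : 0 < r / 2 by rewrite divr_gt0.
have [s] := rat_in_itvoo r20; rewrite in_itv/= => /andP[s0 sr].
have /choice[q xq] : forall i, exists q : rat, `|ratr q - x 0 i| < ratr s.
  move=> i; have : x 0 i - ratr s < x 0 i + ratr s by rewrite ltrD2l gtrN.
  move=> /rat_in_itvoo[q]; rewrite in_itv/= => xq; exists q.
  by rewrite ltr_distl.
have xp : rational_ball (\row_i q i, s) x.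
  by rewrite /rational_ball/= ball_coords// => i; rewrite !mxE; exact: xq.
exists (\row_i q i, s) => // y py.
apply: (@le_ball _ _ _ (ratr s + ratr s)); first by lra.
by apply: (ball_triangle _ py); exact: ball_sym.
Qed.

Lemma borel_open (O : set V) : open O -> measurable (O : set borelRV).
Proof.
move=> oO.
have E : O = \bigcup_p (if `[< rational_ball p `<=` O >] then rational_ball p
                        else set0).
  apply/seteqP; split => [x Ox|x [p _]]; last first.
    by case: asboolP => // pO /pO.
  have [r /= r0 rO] := (nbhs_ballP x O).1 (open_nbhs_nbhs (conj oO Ox)).
  have [p px pr] := rational_ball_basis x r0; exists p => //.
  by case: asboolP => // -[]; exact: subset_trans rO.
apply: (eq_ind_r (fun A : set borelRV => measurable A) _ E).
apply: countable_bigcupT_measurable => // p; case: asboolP => // _.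
exact: borel_ball.
Qed.

Lemma null_locally (U A : set V) :
  (forall x, U x -> exists2 r, 0 < r & null (ball x r `&` A)) -> null (U `&` A).
Proof.
move=> UA; apply: (@null_sub _ _ _ (\bigcup_p
    (if `[< null (rational_ball p `&` A) >] then rational_ball p `&` A
     else set0))).
  move=> x [Ux Ax]; have [r r0 xr] := UA _ Ux.
  have [p px pr] := rational_ball_basis x r0; exists p => //.
  by case: asboolP => // -[]; apply: null_sub xr; exact: setSI.
apply: null_countable => p; case: asboolP => // _.
exact: (outer_measure0 (@lebesgue_outer R d)).
Qed.

(** This stands in for the fact that balls have positive measure: if one were
null, so would be its translates, countably many of which cover the space. *)
Lemma null_ball_setT (y : V) (r : R) : 0 < r -> null (ball y r) ->
  null [set: V].
Proof.
move=> r0 y0; rewrite -[setT]setIT; apply: null_locally => x _; exists r => //.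
apply: null_sub (null_affine (y - x) ltr01 y0) => z [xz _].
move: xz; rewrite /affine/= scale1r !mx_norm_ball /ball_/=.
by rewrite addrCA opprD addrA subrr add0r opprB.
Qed.

(** Let c be the local constant at some point of Omega. The points near which
u = c almost everywhere form a set O that is open and relatively closed: the
local constants of two overlapping balls agree, because the overlap is not
null. *)
Lemma essentially_constant_local (Omega : set V) (u : V -> R) :
  connected Omega -> (forall x, Omega x -> exists r c,
    [/\ 0 < r, ball x r `<=` Omega & null (ball x r `&` [set y | u y <> c])]) ->
  essentially_constant Omega u.
Proof.
move=> cO loc.
suff [c uc] : exists c, null (Omega `&` [set y | u y <> c]).
  exists c; apply/negligible_null; apply: null_sub uc => x /=.
  by move=> /not_implyP.
have [VT|VT] := pselect (null [set: V]); first by exists 0; exact: null_sub VT.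
have [[x0 Ox0]|/forallNP O0] := pselect (exists x, Omega x); last first.
  exists 0; rewrite (_ : _ `&` _ = set0); last first.
    by rewrite -subset0 => x [/O0].
  exact: (outer_measure0 (@lebesgue_outer R d)).
have [r0 [c [r00 Or0 uc]]] := loc _ Ox0; exists c.
pose O x := exists r,
  [/\ 0 < r, ball x r `<=` Omega & null (ball x r `&` [set y | u y <> c])].
have openO : open O.
  rewrite openE => x [r [rgt0 rO ru]]; apply/nbhs_ballP.
  exists (r / 2) => /=; first exact: divr_gt0.
  move=> y xy; exists (r / 2).
  have yx : ball y (r / 2) `<=` ball x r.
    move=> z yz; rewrite [r]splitr; exact: ball_triangle xy yz.
  split; first exact: divr_gt0.
    exact: subset_trans rO.
  by apply: null_sub ru; exact: setSI.
have -> : Omega = Omega `&` O.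
  apply/esym/cO; first by exists x0; split => //; exists r0.
    by exists O.
  exists (closure O); first exact: closed_closure.
  apply/seteqP; split => x [Ox]; first by split => //; exact: subset_closure.
  move=> clx; split => //; have [r [c' [rgt0 rO ru]]] := loc _ Ox.
  have [cE|cc'] := eqVneq c c'; first by exists r; rewrite cE.
  have [y [[s [s0 sO su]] xy]] := clx _ (nbhsx_ballx x r rgt0).
  have /nbhs_ballP[t /= t0 ty] : nbhs y (ball x r `&` ball y s).
    apply: filterI; last exact: nbhsx_ballx.
    by apply: open_nbhs_nbhs; split => //; exact: ball_open.
  suff : null (ball y t) by move=> /(null_ball_setT t0).
  apply: null_sub (null_setU ru su) => z /ty[xz yz].
  have [uc'|uc'] := pselect (u z = c'); last by left.
  by right; split => //= uzc; move: cc'; rewrite -uzc uc' eqxx.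
apply: null_sub (@null_locally O [set y | u y <> c] _).
  by move=> x [[_ ?] ?].
by move=> x [r [? _ ?]]; exists r.
Qed.

End local_global.

(** * The kernel in the variables x and h *)

Section kernel.
Context {R : realType} {d : nat}.
Local Notation V := 'rV[R]_d.+1.
Local Notation L := (lebRV R d).
Local Notation mu := (@lebesgue_measure_rV R d).
Local Notation borelRV := (g_sigma_algebraType (@halfspaces R d)).
Implicit Types (x h : V).

Definition enorm h : R := euclid_dist h 0.

Lemma enorm_ge0 h : 0 <= enorm h.
Proof. exact: sqrtr_ge0. Qed.

Lemma euclid_distDl x h : euclid_dist (x + h) x = enorm h.
Proof.
congr Num.sqrt; apply: eq_bigr => i _; rewrite !mxE subr0.
by rewrite [x 0 i + _]addrC addrK.
Qed.

Lemma enormZ (c : R) h : 0 <= c -> enorm (c *: h) = c * enorm h.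
Proof.
move=> c0; rewrite /enorm /euclid_dist -[in RHS](ger0_norm c0) -sqrtr_sqr.
rewrite -sqrtrM ?sqr_ge0// mulr_sumr; congr Num.sqrt; apply: eq_bigr => i _.
by rewrite !mxE !subr0 exprMn.
Qed.

Lemma enorm_gt0 h : h != 0 -> 0 < enorm h.
Proof.
move=> h0; have [i hi] : exists i, h 0 i != 0.
  apply: contrapT => /forallNP h'; move/eqP : h0; apply; apply/rowP => i.
  by have /negP := h' i; rewrite negbK mxE => /eqP.
rewrite sqrtr_gt0 (bigD1 i)//= mxE subr0 ltr_wpDr//.
  by apply: sumr_ge0 => j _; exact: sqr_ge0.
by rewrite lt_neqAle sqr_ge0 andbT eq_sym expf_neq0.
Qed.

Lemma measurable_euclid_dist : measurable_fun (setT : set (borelRV * borelRV))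
  ((fun p => euclid_dist (p.2 : V) (p.1 : V)) : borelRV * borelRV -> R).
Proof.
apply: (@measurableT_comp _ _ _ _ _ _ (@Num.sqrt R)).
  exact: (continuous_measurable_fun (@sqrt_continuous R)).
apply: measurable_sum => i; apply: measurable_funX; apply: measurable_funB.
  exact: (measurableT_comp (measurable_coord i) measurable_snd).
exact: (measurableT_comp (measurable_coord i) measurable_fst).
Qed.

Lemma measurable_id2_borel : measurable_fun (setT : set (L * L))
  ((fun p => (p.1, p.2)) : L * L -> borelRV * borelRV).
Proof.
apply: measurable_fun_pair.
  exact: (measurableT_comp measurable_id_borel measurable_fst).
exact: (measurableT_comp measurable_id_borel measurable_snd).
Qed.

Lemma measurable_shear : measurable_fun (setT : set (L * L))
  ((fun p => (p.1, (p.1 : V) + p.2)) : L * L -> borelRV * borelRV).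
Proof.
apply: measurable_fun_pair; last exact: measurable_add_borel.
exact: (measurableT_comp measurable_id_borel measurable_fst).
Qed.

Section shear.
Variable f : V -> V -> \bar R.
Hypothesis f_ge0 : forall x y, (0 <= f x y)%E.
Hypothesis mf : measurable_fun (setT : set (borelRV * borelRV))
  ((fun p => f p.1 p.2) : borelRV * borelRV -> \bar R).

Lemma measurable_shear_comp : measurable_fun (setT : set (L * L))
  ((fun p => f p.1 ((p.1 : V) + p.2)) : L * L -> \bar R).
Proof. exact: (measurableT_comp mf measurable_shear). Qed.

Lemma measurable_id2_comp : measurable_fun (setT : set (L * L))
  ((fun p => f p.1 p.2) : L * L -> \bar R).
Proof. exact: (measurableT_comp mf measurable_id2_borel). Qed.

(** Translate the inner variable by x, and exchange the two integrals. *)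
Lemma tonelli_shear :
  (\int[mu]_x \int[mu]_y f x y = \int[mu]_h \int[mu]_x f x ((x : V) + h)%R)%E.
Proof.
rewrite -(fubini_tonelli (fun p : L * L => f p.1 ((p.1 : V) + p.2)%R)
  measurable_shear_comp)//=.
apply: eq_integral => x _.
have mfx : measurable_fun (setT : set L) (f x : L -> \bar R).
  exact: (measurable_fun_pair2 _ measurable_id2_comp).
rewrite -(ge0_integral_translate x mfx)//; apply: eq_integral => y _.
by rewrite addrC.
Qed.

End shear.

Section weight.
Variables (omega : R -> R) (D : set V) (v : V -> R).
Hypothesis omega_ge0 : forall m : R, 0 <= m -> 0 <= omega m.
Hypothesis omega_nondecreasing :
  forall m1 m2 : R, 0 <= m1 -> m1 <= m2 -> omega m1 <= omega m2.
Hypothesis mD : measurable (D : set borelRV).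
Hypothesis mv : measurable_fun (setT : set borelRV) (v : borelRV -> R).

Definition rate x y : R := `|v y - v x| / euclid_dist y x.

Lemma rate_ge0 x y : 0 <= rate x y.
Proof. by rewrite divr_ge0// sqrtr_ge0. Qed.

Definition weight x y : R := \1_D x * \1_D y * omega (rate x y).

Lemma weight_ge0 x y : 0 <= weight x y.
Proof. by rewrite !mulr_ge0// omega_ge0// rate_ge0. Qed.

Lemma measurable_indic2 : measurable_fun (setT : set (borelRV * borelRV))
  ((fun p => \1_D (p.1 : V) * \1_D (p.2 : V)) : borelRV * borelRV -> R).
Proof.
have m1 : measurable_fun (setT : set borelRV) (\1_D : borelRV -> R).
  exact: measurable_indic.
apply: measurable_funM; first exact: (measurableT_comp m1 measurable_fst).
exact: (measurableT_comp m1 measurable_snd).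
Qed.

Lemma measurable_weight : measurable_fun (setT : set (borelRV * borelRV))
  ((fun p => weight p.1 p.2) : borelRV * borelRV -> R).
Proof.
apply: measurable_funM; first exact: measurable_indic2.
apply: (measurable_omega_comp omega_nondecreasing); last first.
  by move=> p; exact: rate_ge0.
apply: measurable_funM; last first.
  exact: (measurableT_comp measurable_invr measurable_euclid_dist).
apply: measurableT_comp => //; apply: measurable_funB.
  exact: (measurableT_comp mv measurable_snd).
exact: (measurableT_comp mv measurable_fst).
Qed.

Definition cut_kernel x y : R := weight x y / euclid_dist y x ^+ d.+1.

Lemma cut_kernel_ge0 x y : 0 <= cut_kernel x y.
Proof. by rewrite divr_ge0 ?weight_ge0// exprn_ge0// sqrtr_ge0. Qed.

Lemma measurable_cut_kernel : measurable_fun (setT : set (borelRV * borelRV))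
  ((fun p => cut_kernel p.1 p.2) : borelRV * borelRV -> R).
Proof.
apply: measurable_funM; first exact: measurable_weight.
apply: (measurableT_comp measurable_invr).
by apply: measurable_funX; exact: measurable_euclid_dist.
Qed.

(** The integral of a nonnegative function is a supremum over the simple
functions below it, so the pointwise comparison of the kernels suffices. *)
Lemma cut_kernel_le_Fomega (u : V -> R) (Omega : set V) :
  D `<=` Omega -> (forall x, D x -> v x = u x) ->
  (\int[mu]_x \int[mu]_y (cut_kernel x y)%:E <= Fomega omega u Omega)%E.
Proof.
move=> DO vu.
have mK : measurable_fun (setT : set (L * L))
    ((fun p => (cut_kernel p.1 p.2)%:E) : L * L -> \bar R).
  apply: (@measurable_id2_comp (fun x y => (cut_kernel x y)%:E)).
  by apply/measurable_EFinP; exact: measurable_cut_kernel.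
have K0 (p : L * L) : (0 <= (cut_kernel p.1 p.2)%:E)%E.
  by rewrite lee_fin cut_kernel_ge0.
have F0 (p : L * L) : (0 <= (Fkernel omega u p.1 p.2)%:E)%E.
  rewrite lee_fin /Fkernel divr_ge0 ?exprn_ge0 ?sqrtr_ge0// omega_ge0//.
  by rewrite divr_ge0// sqrtr_ge0.
rewrite -(fubini_tonelli1 (fun p : L * L => (cut_kernel p.1 p.2)%:E) mK K0).
rewrite /Fomega ge0_integralTE// ge0_integralE//.
apply: le_ereal_sup => _ [s /= sK <-]; exists s => // -[x y].
apply: (le_trans (sK (x, y))); rewrite patchE/=.
have [xyO|xyO] := boolP ((x, y) \in _); last first.
  rewrite lee_fin /cut_kernel /weight !indicE.
  case: (boolP (x \in D)) => [|_]; last by rewrite !mul0r.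
  case: (boolP (y \in D)) => [|_]; last by rewrite mulr0 !mul0r.
  rewrite !inE => Dy Dx; exfalso; move: xyO; rewrite notin_setE; apply.
  by split; exact: DO.
rewrite lee_fin /cut_kernel /weight !indicE.
case: (boolP (x \in D)) => [|_]; last first.
  by rewrite !mul0r -lee_fin; exact: (F0 (x, y)).
case: (boolP (y \in D)) => [|_]; last first.
  by move=> _; rewrite mulr0 !mul0r -lee_fin; exact: (F0 (x, y)).
by rewrite !inE => Dy Dx; rewrite /rate !mul1r !vu.
Qed.

End weight.
End kernel.

(** * The energy in a direction *)

Section null_integral.
Context {R : realType} {d : nat}.
Local Notation V := 'rV[R]_d.+1.
Local Notation L := (lebRV R d).
Local Notation mu := (@lebesgue_measure_rV R d).
Variable f : V -> \bar R.
Hypothesis mf : measurable_fun (setT : set L) (f : L -> \bar R).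
Hypothesis f_ge0 : forall x, (0 <= f x)%E.

Lemma ge0_integral_eq0P :
  (\int[mu]_x f x = 0)%E <-> null [set x | f x <> 0%E].
Proof.
have fE : (\int[mu]_x f x = \int[mu]_x `|f x|)%E.
  by apply: eq_integral => x _; rewrite gee0_abs.
rewrite fE; apply: (iff_trans (ae_eq_integral_abs mu measurableT mf)).
apply: (iff_trans (negligible_null _)).
have -> // : ~` [set x : L | setT x -> f x = cst 0%E x] = [set x | f x <> 0%E].
by apply/seteqP; split => x /= h => [fx0|]; [apply: h|move=> /(_ I)].
Qed.

Lemma ge0_integral_lty_null (A : set V) : measurable (A : set L) ->
  (\int[mu]_(x in A) f x < +oo)%E -> null (A `&` [set x | f x = +oo%E]).
Proof.
move=> mA foo; apply: null_sub ((negligible_null _).1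
    (@integrable_ae _ _ _ mu A mA f _)).
  by move=> x [Ax /= fx] /(_ Ax); rewrite fx.
apply/integrableP; split; first exact: measurable_funTS.
apply: le_lt_trans foo; rewrite le_eqVlt; apply/orP; left; apply/eqP.
by apply: eq_integral => x _; rewrite gee0_abs.
Qed.

Lemma ge0_integralZlT (k : R) : 0 <= k ->
  (\int[mu]_x (k%:E * f x) = k%:E * \int[mu]_x f x)%E.
Proof.
move=> k0; exact: (@ge0_integralZl_EFin _ _ _ mu setT measurableT f
  (fun x _ => f_ge0 x) mf k k0).
Qed.

End null_integral.

Section directional_energy.
Context {R : realType} {d : nat} (omega : R -> R).
Local Notation V := 'rV[R]_d.+1.
Local Notation L := (lebRV R d).
Local Notation mu := (@lebesgue_measure_rV R d).
Local Notation borelRV := (g_sigma_algebraType (@halfspaces R d)).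
Hypothesis omega_ge0 : forall m : R, 0 <= m -> 0 <= omega m.
Hypothesis omega_nondecreasing :
  forall m1 m2 : R, 0 <= m1 -> m1 <= m2 -> omega m1 <= omega m2.
Variables (D : set V) (v : V -> R).
Hypothesis mD : measurable (D : set borelRV).
Hypothesis mv : measurable_fun (setT : set borelRV) (v : borelRV -> R).

Definition shifted_weight (x h : V) : R := weight omega D v x (x + h).

(** This is I (h) in the introduction. *)
Definition directional_energy (h : V) : \bar R :=
  (\int[mu]_x (shifted_weight x h)%:E)%E.

Lemma shifted_weight_ge0 x h : 0 <= shifted_weight x h.
Proof. exact: weight_ge0. Qed.

Lemma measurable_shifted_weight : measurable_fun (setT : set (L * L))
  ((fun p => (shifted_weight p.1 p.2)%:E) : L * L -> \bar R).
Proof.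
apply: (@measurable_shear_comp _ _ (fun x y => (weight omega D v x y)%:E)).
by apply/measurable_EFinP; exact: measurable_weight.
Qed.

Lemma measurable_directional_energy :
  measurable_fun (setT : set L) (directional_energy : L -> \bar R).
Proof.
apply: (measurable_fun_fubini_tonelli_G
  (fun p : L * L => (shifted_weight p.1 p.2)%:E)).
  exact: measurable_shifted_weight.
by move=> p; rewrite lee_fin shifted_weight_ge0.
Qed.

Lemma directional_energy_ge0 h : (0 <= directional_energy h)%E.
Proof. by apply: integral_ge0 => x _; rewrite lee_fin shifted_weight_ge0. Qed.

Local Notation I := directional_energy.

Let K x h : \bar R := (cut_kernel omega D v x (x + h))%:E.
Let Phi (h : V) : \bar R := (\int[mu]_x K x h)%E.
Let e (h : V) : R := (enorm h ^+ d.+1)^-1.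

Let e_ge0 h : 0 <= e h.
Proof. by rewrite invr_ge0 exprn_ge0// enorm_ge0. Qed.

Let me : measurable_fun (setT : set L) (e : L -> R).
Proof.
apply: (measurableT_comp measurable_invr); apply: measurable_funX.
have := @measurable_fun_pair2 _ _ _ _ _ _ _ (0 : borelRV)
  (@measurable_euclid_dist R d).
by move=> H; exact: (measurableT_comp H measurable_id_borel).
Qed.

Let Phi_ge0 h : (0 <= Phi h)%E.
Proof. by apply: integral_ge0 => x _; rewrite lee_fin cut_kernel_ge0. Qed.

Let PhiE h : (Phi h = (e h)%:E * I h)%E.
Proof.
have mW : measurable_fun (setT : set L)
    ((fun x => (shifted_weight x h)%:E) : L -> \bar R).
  exact: (measurable_fun_pair1 _ measurable_shifted_weight).
have W0 x : (0 <= (shifted_weight x h)%:E)%E.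
  by rewrite lee_fin shifted_weight_ge0.
apply: (etrans _ (ge0_integralZlT mW W0 (e_ge0 h))).
by apply: eq_integral => x _; rewrite -EFinM mulrC /K /cut_kernel euclid_distDl.
Qed.

Let mPhi : measurable_fun (setT : set L) (Phi : L -> \bar R).
Proof.
apply: (eq_measurable_fun (fun h : L => ((e h)%:E * I h)%E)).
  by move=> h _; rewrite PhiE.
apply: emeasurable_funM; last exact: measurable_directional_energy.
by apply/measurable_EFinP; exact: me.
Qed.

Let affine0 (c : R) (h : V) : affine c 0 h = c *: h.
Proof. by rewrite /affine addr0. Qed.

Let ball0_scale (c s : R) (h : V) : 0 < c ->
  ball (0 : V) (c * s) (c *: h) <-> ball (0 : V) s h.
Proof.
move=> c0; split=> -[s0 hs]; split.
- by move: s0; rewrite pmulr_rgt0.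
- move=> i j; have := hs i j; rewrite -!ball_normE /ball_/= !mxE !sub0r !normrN.
  by rewrite normrM gtr0_norm// ltr_pM2l.
- by rewrite mulr_gt0.
- move=> i j; have := hs i j; rewrite -!ball_normE /ball_/= !mxE !sub0r !normrN.
  by rewrite normrM gtr0_norm// ltr_pM2l.
Qed.

(* The balls are those of the sup norm: they are boxes, and they scale under
dilations like the Euclidean ones. *)
Let annulus (s : R) : set V := ball (0 : V) s `\` ball (0 : V) (s / 2).

Let annulus_scale (c s : R) (h : V) : 0 < c ->
  annulus (c * s) (c *: h) <-> annulus s h.
Proof.
move=> c0; rewrite /annulus -mulrA; split=> -[h1 h2]; split.
- by move/ball0_scale : h1; apply.
- by move=> h3; apply: h2; apply/ball0_scale.
- exact/ball0_scale.
- by move=> h3; apply: h2; move/ball0_scale : h3; apply.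
Qed.

Let measurable_annulus s : measurable (annulus s : set L).
Proof. by apply: borel_measurable; apply: measurableD; exact: borel_ball. Qed.

Let annulus_neq0 s h : 0 < s -> annulus s h -> h != 0.
Proof.
move=> s0 [_ hs]; apply/eqP => h0; apply: hs; rewrite h0.
by apply: ballxx; rewrite divr_gt0.
Qed.

Let trivIset_annulus s : trivIset setT (fun k => annulus (2 ^- k * s)).
Proof.
apply/trivIsetP => i j _ _; wlog ij : i j / (i < j)%N => [H|_].
  rewrite neq_ltn => /orP[ij|ji]; first by rewrite H// ltn_eqF.
  by rewrite setIC H// ltn_eqF.
rewrite -subset0 => x [[_ xi] [xj _]]; apply: xi.
have s0 : 0 < s.
  by move: xj => [+ _]; rewrite pmulr_rgt0// invr_gt0 exprn_gt0.
apply: le_ball xj; rewrite mulrAC ler_pM2r// -invfM -exprSr.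
by rewrite lef_pV2 ?posrE ?exprn_gt0// ler_weXn2l// ler1n.
Qed.

(** The dilation by 2 ^ - k contributes the factor 2 ^ - k (d + 1), which
cancels the one coming from the homogeneity of the weight e. *)
Let integral_annulus s k : (\int[mu]_(h in annulus (2 ^- k * s)) Phi h =
  \int[mu]_(h in annulus s) ((e h)%:E * I (iter k half h)))%E.
Proof.
have c0 : 0 < 2 ^- k :> R by rewrite invr_gt0 exprn_gt0.
set c : R := 2 ^- k in c0 *.
rewrite integral_mkcond [RHS]integral_mkcond.
have mr : measurable_fun (setT : set L)
    (Phi \_ (annulus (c * s)) : L -> \bar R).
  apply/(measurable_restrictT _ (measurable_annulus _)).1.
  exact: measurable_funTS.
have r0 h : (0 <= (Phi \_ (annulus (c * s))) h)%E by exact: erestrict_ge0.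
have H := ge0_integral_affine 0 c0 mr r0.
have cd : c ^+ d.+1 != 0 by rewrite expf_neq0// gt_eqF.
have -> : (\int[mu]_x (Phi \_ (annulus (c * s))) x =
    (c ^+ d.+1)%:E * \int[mu]_x (Phi \_ (annulus (c * s))) (affine c 0 x))%E.
  by rewrite H muleA -EFinM -exprMn mulfV ?gt_eqF// expr1n mul1e.
have mra := measurableT_comp mr (measurable_affine 0 c0).
rewrite -(ge0_integralZlT mra (fun h => r0 _)) ?exprn_ge0 ?(ltW c0)//.
apply: eq_integral => h _; rewrite /= !patchE (affine0 c (h : V)).
have sE := annulus_scale s (h : V) c0.
have [hs|hs] := pselect (annulus s (h : V)); last first.
  rewrite (memNset hs) memNset ?mule0//.
  by move=> /sE.
rewrite (mem_set hs) mem_set; last exact/sE.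
rewrite PhiE half_iter -/c muleA -EFinM; congr (_%:E * _)%E.
by rewrite /e enormZ ?ltW// exprMn invfM mulrA mulfV// mul1r.
Qed.

(** The annuli with radii s / 2 ^ k are disjoint, so the sum over k of the
integrals of [integral_annulus] is at most the total integral. *)
Let null_annulus s : 0 < s -> (\int[mu]_h Phi h < +oo)%E ->
  null (annulus s `&` [set h | \sum_(k <oo) I (iter k half h) = +oo]%E).
Proof.
move=> s0 Phioo.
pose g h : \bar R := (\sum_(k <oo) ((e h)%:E * I (iter k half h)))%E.
have mt k : measurable_fun (setT : set L)
    ((fun h => ((e h)%:E * I (iter k half h))%E) : L -> \bar R).
  apply: emeasurable_funM; first by apply/measurable_EFinP; exact: me.
  have c0 : 0 < 2 ^- k :> R by rewrite invr_gt0 exprn_gt0.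
  have := measurableT_comp measurable_directional_energy
    (measurable_affine 0 c0).
  by congr measurable_fun; apply/funext => h /=; rewrite affine0 half_iter.
have t0 k h : (0 <= (e h)%:E * I (iter k half h))%E.
  by apply: mule_ge0; [rewrite lee_fin|exact: directional_energy_ge0].
have mg : measurable_fun (setT : set L) (g : L -> \bar R).
  exact: ge0_emeasurable_sum.
have g0 h : (0 <= g h)%E by exact: nneseries_ge0.
have goo : (\int[mu]_(h in annulus s) g h < +oo)%E.
  rewrite /g (@integral_nneseries _ _ _ mu (annulus s) (measurable_annulus s)
    (fun k h => ((e h)%:E * I (iter k half h))%E)
    (fun k => measurable_funTS (mt k)) (fun k h _ => t0 k h)).
  apply: le_lt_trans Phioo.
  pose U := \bigcup_k annulus (2 ^- k * s).
  have mU : measurable (U : set L).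
    by apply: bigcupT_measurable => k; exact: measurable_annulus.
  apply: (@le_trans _ _ (\int[mu]_(h in U) Phi h)%E); last first.
    exact: (@ge0_subset_integral _ _ _ mu U setT mU measurableT Phi mPhi
      (fun h _ => Phi_ge0 h) (@subsetT _ U)).
  rewrite /U (@ge0_integral_bigcup _ _ _ mu (fun k => annulus (2 ^- k * s)) Phi
    (fun k => measurable_annulus _) (measurable_funTS mPhi)
    (fun h _ => Phi_ge0 h) (@trivIset_annulus s)).
  rewrite le_eqVlt; apply/orP; left; apply/eqP.
  by apply: eq_eseriesr => k _; rewrite integral_annulus.
apply: null_sub (ge0_integral_lty_null mg g0 (measurable_annulus s) goo).
move=> h [sh /= Ih]; split => //=.
rewrite /g nneseriesZl; last by move=> k _; exact: directional_energy_ge0.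
rewrite Ih gt0_muley// lte_fin invr_gt0 exprn_gt0// enorm_gt0//.
exact: annulus_neq0 sh.
Qed.

(** Countably many annuli, with rational radii s, cover the nonzero
directions. *)
Lemma null_directional_energy_series :
  (\int[mu]_h \int[mu]_x (cut_kernel omega D v x ((x : V) + h)%R)%:E < +oo)%E ->
  null [set h | h != 0 /\ (\sum_(k <oo) I (iter k half h) = +oo)%E].
Proof.
move=> Phioo; apply: (@null_sub _ _ _ (\bigcup_(q : rat)
  (if 0 < q then annulus (ratr q) `&`
     [set h | (\sum_(k <oo) I (iter k half h) = +oo)%E]
   else set0))); last first.
  apply: null_countable => q; case: ifPn => q0.
    by apply: null_annulus => //; rewrite ltr0q.
  exact: (outer_measure0 (@lebesgue_outer R d)).
move=> h /= [h0 hoo].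
have nh : 0 < `|h| by rewrite normr_gt0.
have : `|h| < 2 * `|h| by rewrite ltr_pMl// ltr1n.
move=> /rat_in_itvoo[q]; rewrite in_itv/= => /andP[hq qh].
have q0 : 0 < q by rewrite -(ltr0q R) (lt_trans nh).
exists q => //; rewrite q0; split => //.
rewrite /annulus mx_norm_ball /ball_ /=; split; rewrite /= sub0r normrN//.
by rewrite ltr_pdivlMr// mulrC; apply/negP; rewrite -leNgt ltW.
Qed.

End directional_energy.

(** * Essential constancy on a ball *)

Section jump_in_direction.
Context {R : realType} {d : nat} (omega : R -> R).
Local Notation V := 'rV[R]_d.+1.
Local Notation L := (lebRV R d).
Local Notation mu := (@lebesgue_measure_rV R d).
Local Notation borelRV := (g_sigma_algebraType (@halfspaces R d)).
Hypothesis omega_ge0 : forall m : R, 0 <= m -> 0 <= omega m.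
Hypothesis omega_nondecreasing :
  forall m1 m2 : R, 0 <= m1 -> m1 <= m2 -> omega m1 <= omega m2.
Hypothesis omega_gt0 : forall m : R, 0 < m -> 0 < omega m.
Hypothesis omega_series : forall A : R, exists n,
  A <= \sum_(j < n) omega (2 ^+ j.+1) / 2 ^+ j.+1.
Variables (z : V) (r : R) (Z : set V) (v : V -> R).
Hypothesis mZ : measurable (Z : set borelRV).
Hypothesis Z0 : null Z.
Hypothesis mv : measurable_fun (setT : set borelRV) (v : borelRV -> R).

Let B : set V := ball z r.
Let D : set V := B `\` Z.
Let mD : measurable (D : set borelRV).
Proof. by apply: measurableD => //; exact: borel_ball. Qed.

Local Notation W := (shifted_weight omega D v).
Local Notation I := (directional_energy omega D v).

Let W_ge0 x h : 0 <= W x h.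
Proof. exact: shifted_weight_ge0. Qed.

Let mW := measurable_shifted_weight omega_nondecreasing mD mv.

Let measurable_translate (f : V -> R) a :
  measurable_fun (setT : set L) (f : L -> R) ->
  measurable_fun (setT : set L) ((fun x => f ((x : V) + a)) : L -> R).
Proof.
move=> mf; have := measurableT_comp mf (measurable_affine a ltr01).
by congr measurable_fun; apply/funext => x /=; rewrite /affine scale1r.
Qed.

Let measurable_dyadic_sum k h :
  measurable_fun (setT : set L) ((dyadic_sum W k)^~ h : L -> R).
Proof.
elim: k h => [|k IH] h /=.
  apply/measurable_EFinP; exact: (measurable_fun_pair1 _ mW).
apply: measurable_funD; first exact: IH.
exact: (@measurable_translate ((dyadic_sum W k)^~ (half h)) _ (IH _)).
Qed.

Let dyadic_sum_W_ge0 k x h : 0 <= dyadic_sum W k x h.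
Proof. exact: dyadic_sum_ge0. Qed.

(** By translation invariance, all the 2 ^ k pieces contribute the same
integral. *)
Let integral_dyadic_sum k h : (\int[mu]_x (dyadic_sum W k x h)%:E =
  (2 ^+ k)%:E * I (iter k half h))%E.
Proof.
elim: k h => [|k IH] h; first by rewrite expr0 mul1e.
have ms (a : V) : measurable_fun (setT : set L)
    ((fun x => (dyadic_sum W k ((x : V) + a) (half h))%:E) : L -> \bar R).
  apply/measurable_EFinP.
  exact: (@measurable_translate (dyadic_sum W k ^~ _)).
have ms0 : measurable_fun (setT : set L)
    ((fun x => (dyadic_sum W k x (half h))%:E) : L -> \bar R).
  exact/measurable_EFinP.
have s0 (y g : V) : (0 <= (dyadic_sum W k y g)%:E)%E by rewrite lee_fin.
under eq_integral do rewrite /= EFinD.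
rewrite ge0_integralD//.
rewrite (@ge0_integral_translate _ _ (half h)
  (fun x => (dyadic_sum W k x (half h))%:E) ms0)//.
rewrite IH iterSr -ge0_muleDl ?lee_fin ?exprn_ge0//.
by rewrite -EFinD exprS mulr2n mulrDl mul1r.
Qed.

(* The segments all of whose dyadic subdivision points lie in D: the ball is
convex, and the points of Z are excluded. *)
Let chain (x h : V) : Prop :=
  [/\ B x, B (x + h), h != 0 &
    forall k i : nat, ~ Z (x + (i%:R * 2 ^- k) *: h)].

Let half_neq0 (h : V) : h != 0 -> half h != 0.
Proof. by move=> h0; rewrite /half scaler_eq0 negb_or h0 andbT invr_eq0. Qed.

Let chain_stable : dyadic_stable chain.
Proof.
move=> x h [Bx Bxh h0 hZ].
have Bm : B (x + half h).
  move: Bx Bxh => [r0 Bx] [_ Bxh]; split => // i j.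
  move: (Bx i j) (Bxh i j); rewrite /half -!ball_normE /ball_/= !mxE.
  by rewrite !ltr_norml => /andP[? ?] /andP[? ?]; apply/andP; split; lra.
have hh0 := half_neq0 h0.
split.
  split=> // k i; have := hZ k.+1 i.
  by rewrite /half scalerA -mulrA -invfM mulrC -exprSr.
split=> //; first by rewrite -addrA halfD.
move=> k i; have := hZ k.+1 (2 ^ k + i)%N.
  congr (~ Z _); rewrite -addrA; congr (_ + _).
  rewrite /half scalerA -scalerDl; congr (_ *: _).
  rewrite natrD natrX exprS; field.
  by rewrite expf_neq0.
Qed.

Let rate_midpoint x h : chain x h ->
  rate v x (x + h) <=
  (rate v x (x + half h) + rate v (x + half h) (x + half h + half h)) / 2.
Proof.
move=> [_ _ h0 _]; have n0 := enorm_gt0 h0.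
have nh : enorm (half h) = enorm h / 2 by rewrite enormZ ?invr_ge0// mulrC.
have xh : x + h = x + half h + half h by rewrite -addrA halfD.
rewrite /rate (euclid_distDl x h) (euclid_distDl x (half h)).
rewrite (euclid_distDl (x + half h) (half h)) nh xh.
move: (v x) (v (x + half h)) (v (x + half h + half h)) => a b c.
have -> : (`|b - a| / (enorm h / 2) + `|c - b| / (enorm h / 2)) / 2 =
    (`|b - a| + `|c - b|) / enorm h by field; rewrite gt_eqF.
rewrite ler_pM2r ?invr_gt0//.
by rewrite (_ : c - a = (b - a) + (c - b)) ?ler_normD//; ring.
Qed.

Let dyadic_series_pinfty x h : chain x h -> v (x + h) != v x ->
  (\sum_(k <oo) (2 ^- k * dyadic_sum W k x h)%:E = +oo)%E.
Proof.
move=> cxh vxh; apply/eqyP => A A0.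
have q0 : 0 < rate v x (x + h).
  rewrite divr_gt0 ?normr_gt0 ?subr_eq0// euclid_distDl enorm_gt0//.
  by have [] := cxh.
have [N AN] := dyadic_sum_diverges omega_ge0 omega_nondecreasing omega_gt0
  omega_series chain_stable (fun y g => rate_ge0 v y (y + g)) rate_midpoint
  A cxh q0.
apply: (@le_trans _ _ (\sum_(k < N) (2 ^- k * dyadic_sum W k x h)%:E)%E).
  rewrite sumEFin lee_fin (le_trans (ltW AN))//; apply: ler_sum => k _.
  rewrite ler_pM2l ?invr_gt0 ?exprn_gt0//.
  apply: (@le_dyadic_sum _ _ chain _ _ k x h chain_stable _ cxh).
  move=> y g [By Byg _ gZ].
  rewrite /shifted_weight /weight !indicE !mem_set ?mul1r//.
    by split => //; have := gZ 0%N 1%N; rewrite expr0 divr1 scale1r.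
  by split => //; have := gZ 0%N 0%N; rewrite mul0r scale0r addr0.
rewrite -(big_mkord xpredT (fun k => (2 ^- k * dyadic_sum W k x h)%:E)).
apply: nneseries_lim_ge => k _ _.
by rewrite lee_fin mulr_ge0// invr_ge0 exprn_ge0.
Qed.

Let null_dyadic h :
  null [set x | exists k i : nat, Z (x + (i%:R * 2 ^- k) *: h)].
Proof.
apply: (@null_sub _ _ _ (\bigcup_(p : nat * nat)
   (affine 1 ((p.2%:R * 2 ^- p.1) *: h) @^-1` Z))).
  by move=> x [k [i Zx]]; exists (k, i) => //=; rewrite /affine scale1r.
by apply: null_countable => p; exact: null_affine.
Qed.

Let jump h : set V := [set x | [/\ D x, D (x + h) & v (x + h) != v x]].

(** The integral over x of the series of [dyadic_series_pinfty] is the sum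
over k of the energies, so that series is finite for almost every x, whereas
it is infinite at every jump whose segment avoids Z. *)
Let null_jump h : (\sum_(k <oo) I (iter k half h) < +oo)%E -> null (jump h).
Proof.
move=> Ioo.
have [h0|h0] := eqVneq h 0.
  rewrite (_ : jump h = set0); last first.
    by rewrite -subset0 => x [_ _]; rewrite h0 addr0 eqxx.
  exact: (outer_measure0 (@lebesgue_outer R d)).
have ms k : measurable_fun (setT : set L)
    ((fun x => (2 ^- k * dyadic_sum W k x h)%:E) : L -> \bar R).
  apply/measurable_EFinP; apply: measurable_funM => //.
have s0 k x : (0 <= (2 ^- k * dyadic_sum W k x h)%:E)%E.
  by rewrite lee_fin mulr_ge0// invr_ge0 exprn_ge0.
have E : (\int[mu]_x \sum_(k <oo) (2 ^- k * dyadic_sum W k x h)%:E =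
    \sum_(k <oo) I (iter k half h))%E.
  rewrite (@integral_nneseries _ _ _ mu setT measurableT
    (fun k x => (2 ^- k * dyadic_sum W k x h)%:E) ms (fun k x _ => s0 k x)).
  apply: eq_eseriesr => k _.
  have mk : measurable_fun (setT : set L)
      ((fun x => (dyadic_sum W k x h)%:E) : L -> \bar R).
    by apply/measurable_EFinP; exact: measurable_dyadic_sum.
  have k0 x : (0 <= (dyadic_sum W k x h)%:E)%E by rewrite lee_fin.
  have c0 : 0 <= 2 ^- k :> R by rewrite invr_ge0 exprn_ge0.
  apply: (etrans (ge0_integralZlT mk k0 c0)).
  rewrite integral_dyadic_sum muleA -EFinM mulVf ?mul1e//.
pose g (x : V) := (\sum_(k <oo) (2 ^- k * dyadic_sum W k x h)%:E)%E.
have mg : measurable_fun (setT : set L) (g : L -> \bar R).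
  by apply: ge0_emeasurable_sum => [k x _ _|k _]; [exact: s0|exact: ms].
have g0 x : (0 <= g x)%E by apply: nneseries_ge0 => k _ _; exact: s0.
move: Ioo; rewrite -E => Ioo.
have H := ge0_integral_lty_null mg g0 (@measurableT _ L) Ioo.
apply: null_sub (null_setU H (null_dyadic h)) => x [[Bx _] [Bxh _] vxh].
have [Zx|Zx] := pselect (exists k i : nat, Z (x + (i%:R * 2 ^- k) *: h)).
  by right.
left; split => //=; apply: dyadic_series_pinfty => //; split => //.
by move=> k i Zki; apply: Zx; exists k, i.
Qed.

(** Almost no direction has jumps, so almost no pair of points of D has
distinct values, by Tonelli again; any x in D for which v = v x almost
everywhere on D provides the constant. *)
Lemma cut_kernel_finite_constant :
  (\int[mu]_x \int[mu]_y (cut_kernel omega D v x y)%:E < +oo)%E ->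
  exists c, null (B `&` [set x | ~ Z x /\ v x <> c]).
Proof.
have mK : measurable_fun (setT : set (borelRV * borelRV))
    ((fun p => (cut_kernel omega D v p.1 p.2)%:E) :
       borelRV * borelRV -> \bar R).
  by apply/measurable_EFinP; exact: measurable_cut_kernel.
have K0 (x y : V) : (0 <= (cut_kernel omega D v x y)%:E)%E.
  by rewrite lee_fin cut_kernel_ge0.
rewrite (tonelli_shear K0 mK).
move=> /(null_directional_energy_series omega_ge0 omega_nondecreasing mD mv) N.
have Hdir : null [set h | ~ null (jump h)].
  apply: null_sub N => h /= hj; split.
    apply/eqP => h0; apply: hj; rewrite (_ : jump h = set0).
      exact: (outer_measure0 (@lebesgue_outer R d)).
    by rewrite -subset0 => x [_ _]; rewrite h0 addr0 eqxx.
  apply: contrapT => /= Ih; apply: hj; apply: null_jump.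
  by rewrite ltey; apply/eqP.
(* With omega replaced by the indicator of m > 0, the weight becomes the
indicator of the pairs of points of D with distinct values. *)
pose pos (m : R) : R := (0 < m)%R%:R.
have pos_ge0 m : 0 <= m -> 0 <= pos m by rewrite /pos ler0n.
have pos_nd m1 m2 : 0 <= m1 -> m1 <= m2 -> pos m1 <= pos m2.
  move=> _ m12; rewrite /pos.
  case: (ltP 0 m1) => [m10|_]; last by rewrite ler0n.
  by rewrite (lt_le_trans m10 m12).
pose j x y : \bar R := (weight pos D v x y)%:E.
have j_ge0 x y : (0 <= j x y)%E by rewrite lee_fin weight_ge0.
have mj : measurable_fun (setT : set (borelRV * borelRV))
    ((fun p => j p.1 p.2) : borelRV * borelRV -> \bar R).
  by apply/measurable_EFinP; exact: measurable_weight.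
have jE x y : D x -> D y -> v y <> v x -> j x y <> 0%E.
  move=> Dx Dy vxy; rewrite /j /weight !indicE !mem_set// !mul1r /pos.
  rewrite divr_gt0 ?normr_gt0 ?subr_eq0 ?(introN eqP vxy)//.
    by apply/eqP; rewrite eqe oner_eq0.
  rewrite -[y](subrK x) addrC euclid_distDl enorm_gt0// subr_eq0.
  by apply/eqP => xy; apply: vxy; rewrite xy.
have jE0 x y : j x y <> 0%E -> [/\ D x, D y & v y != v x].
  rewrite /j /weight !indicE.
  have [|_] := boolP (x \in D); last by rewrite !mul0r.
  have [|_] := boolP (y \in D); last by rewrite mulr0 mul0r.
  rewrite !inE => Dy Dx j0; split => //; apply/eqP => vxy; apply: j0.
  by rewrite /pos /rate vxy subrr normr0 mul0r ltxx mulr0.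
have mjs := measurable_shear_comp mj.
have mj2 := measurable_id2_comp mj.
have J0 : (\int[mu]_x \int[mu]_y j x y = 0)%E.
  rewrite (tonelli_shear j_ge0 mj); apply/ge0_integral_eq0P.
  - apply: (measurable_fun_fubini_tonelli_G
      (fun p : L * L => j p.1 ((p.1 : V) + p.2))); first exact: mjs.
    by move=> p; exact: j_ge0.
  - by move=> h; apply: integral_ge0 => x _; exact: j_ge0.
  apply: null_sub Hdir => h /= jh hj; apply: jh; apply/ge0_integral_eq0P.
  - exact: (measurable_fun_pair1 _ mjs).
  - by move=> x; exact: j_ge0.
  - by apply: null_sub hj => x /= /jE0.
have [D0|D0] := pselect (null D).
  by exists 0; apply: null_sub D0 => x [Bx [Zx _]].
have mJ : measurable_fun (setT : set L)
    ((fun x => \int[mu]_y j x y)%E : L -> \bar R).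
  apply: (measurable_fun_fubini_tonelli_F (fun p : L * L => j p.1 p.2)).
    exact: mj2.
  by move=> p; exact: j_ge0.
have J_ge0 x : (0 <= \int[mu]_y j x y)%E.
  by apply: integral_ge0 => y _; exact: j_ge0.
have nJ := (ge0_integral_eq0P mJ J_ge0).1 J0.
have [x Dx jx] : exists2 x, D x & (\int[mu]_y j x y = 0)%E.
  apply: contrapT => H; apply: D0; apply: null_sub nJ => x Dx /= jx.
  by apply: H; exists x.
exists (v x).
have mjx : measurable_fun (setT : set L) (j x : L -> \bar R).
  exact: (measurable_fun_pair2 _ mj2).
have := (ge0_integral_eq0P mjx (j_ge0 x)).1 jx.
by apply: null_sub => y [By [Zy vy]] /=; exact: jE.
Qed.

End jump_in_direction.

Section constant_on_balls.
Context {R : realType} (omega : R -> R).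
Hypothesis omega_ge0 : forall m : R, 0 <= m -> 0 <= omega m.
Hypothesis omega_nondecreasing :
  forall m1 m2 : R, 0 <= m1 -> m1 <= m2 -> omega m1 <= omega m2.
Hypothesis omega_gt0 : forall m : R, 0 < m -> 0 < omega m.
Hypothesis omega_series : forall A : R, exists n,
  A <= \sum_(j < n) omega (2 ^+ j.+1) / 2 ^+ j.+1.

Lemma Fomega_finite_constant_ball (d : nat) (Omega : set 'rV[R]_d.+1)
    (u : 'rV[R]_d.+1 -> R) (z : 'rV[R]_d.+1) (r : R) : open Omega ->
  measurable_fun (Omega : set (lebRV R d)) (u : lebRV R d -> R) ->
  (Fomega omega u Omega < +oo)%E -> ball z r `<=` Omega ->
  exists c, null (ball z r `&` [set y | u y <> c]).
Proof.
move=> oO mu_ Foo BO; have mB := borel_ball z r.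
have mOL := borel_measurable (borel_open oO).
have [Z [v mv [mZ Z0 vu]]] := borel_version mB (measurable_funS mOL BO mu_).
have DO : ball z r `\` Z `<=` Omega by move=> x [/BO].
have := le_lt_trans (cut_kernel_le_Fomega omega_ge0 omega_nondecreasing
  (measurableD mB mZ) mv DO vu) Foo.
move=> /(cut_kernel_finite_constant omega_ge0 omega_nondecreasing omega_gt0
  omega_series mZ Z0 mv)[c cn].
exists c; apply: null_sub (null_setU Z0 cn) => x [Bx ux].
have [Zx|Zx] := pselect (Z x); first by left.
by right; split => //; split => //; rewrite vu.
Qed.

End constant_on_balls.

(** * The theorem *)

Theorem corollary1p6 (R : realType) (omega : R -> R)
  (omega_ge0 : forall m : R, 0 <= m -> 0 <= omega m)
  (omega_nondecreasing :
     forall m1 m2 : R, 0 <= m1 -> m1 <= m2 -> omega m1 <= omega m2)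
  (omega_continuous : {within `[0, +oo[, continuous omega})
  (omega_gt0 : forall m : R, 0 < m -> 0 < omega m)
  (omega_integral :
     (\int[lebesgue_measure]_(m in `[1%R, +oo[) (omega m / m ^+ 2)%:E = +oo)%E)
  (d : nat) (Omega : set 'rV[R]_d.+1)
  (Omega_connected : connected Omega) (Omega_open : open Omega)
  (u : 'rV[R]_d.+1 -> R)
  (u_measurable : measurable_fun (Omega : set (lebRV R d)) (u : lebRV R d -> R))
  (u_nonconstant : ~ essentially_constant Omega u) :
  Fomega omega u Omega = +oo%E.
Proof.
apply: contrapT => Fne; apply: u_nonconstant.
have Foo : (Fomega omega u Omega < +oo)%E by rewrite ltey; apply/eqP.
have omega_series := omega_dyadic_series omega_ge0 omega_nondecreasing
  omega_integral.
apply: essentially_constant_local => // x Ox.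
have [r /= r0 rO] :=
  (nbhs_ballP x Omega).1 (open_nbhs_nbhs (conj Omega_open Ox)).
have [c cr] := Fomega_finite_constant_ball omega_ge0 omega_nondecreasing
  omega_gt0 omega_series Omega_open u_measurable Foo rO.
by exists r, c.
Qed.
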